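(* Let $K_A,K_B$ be state spaces. There exist a constant $c(A,B)$ and an informationally complete measurement $\mathcal M_B:K_B\to\Delta$ into a classical simplex, both depending only on $K_A$ and $K_B$, such that $c(A,B)$ satisfies the following de Finetti bound: for every $n\ge1$ and every $x_{AB}\in\operatorname{Ext}_n(K_A,K_B)$ there is $\tilde x_{AB}\in K_A\dot\otimes K_B$ with $\|\tilde x_{AB}-x_{AB}\|_{\star,1_{K_A\hat\otimes K_B}}\le 2c(A,B)/\sqrt n$; and such that the following holds for this same constant. Let $P$ be a linear functional on $A(K_A)^\star\otimes A(K_B)^\star$, let $F_A,F_B,G_A,G_B$ be linear constraint maps as in the context, and let $$p^*=\min\{P(x_A\otimes x_B): x_A\in K_A,\ x_B\in K_B,\ F_A(x_A)=0,\ F_B(x_B)=0,\ G_A(x_A)\ge0,\ G_B(x_B)\ge0\}.$$ For each $n\in\mathbb N$ let $x^{(n)}_{AB}$ be a minimizer of $P$ over $\Sigma^n(A:B)$, with a corresponding extension $y^{(n)}_{AB^n}$ (satisfying all conditions in the definition of $\Sigma^n(A:B)$). Then there is a sequence $(w^{(n)}_{AB})_{n\ge1}$, where $w^{(n)}_{AB}$ is explicitly constructible from $y^{(n)}_{AB^n}$ by measuring with $\mathcal M_B$ (see context), such that each $w^{(n)}_{AB}$ is feasible for the original problem, in the sense that it is a convex combination of product states $x_A\otimes x_B$ with $x_A\in K_A$, $x_B\in K_B$, $F_A(x_A)=0$, $F_B(x_B)=0$, $G_A(x_A)\ge0$, $G_B(x_B)\ge0$, and $$\left\lVert w^{(n)}_{AB}-x^{(n)}_{AB}\right\rVert_{\star,1_{K_A\hat\otimes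 K_B}}\le\frac{2c(A,B)}{\sqrt n}.$$ Hence $$0\le P(w^{(n)}_{AB})-p^*\le\|P\|_{1_{K_A\hat\otimes K_B}}\frac{2c(A,B)}{\sqrt n},$$ and in particular $P(w^{(n)}_{AB})\to p^*$ as $n\to\infty$.
   Context: A state space is a nonempty compact convex subset $K$ of a finite-dimensional real vector space. $A(K)$ is the space of affine functions $K\to\mathbb R$, $A(K)^+$ the cone of nonnegative ones, $1_K$ the constant function $1$, $E(K)=\{f\in A(K):0\le f\le1_K\}$. $A(K)^\star$ is the dual space with dual cone $A(K)^{\star+}$; $K$ is identified with $\{\phi\in A(K)^{\star+}:\langle\phi,1_K\rangle=1\}$. For cones $C_i\subseteq V_i$, $C_1\hat\otimes C_2=\{z\in V_1\otimes V_2:(f_1\otimes f_2)(z)\ge0\ \forall f_i\in C_i^\star\}$ (iterated associatively). $K_A\hat\otimes K_B$ (and likewise $K_A\hat\otimes K_B^{\hat\otimes n}$) is the set of elements of $A(K_A)^{\star+}\hat\otimes A(K_B)^{\star+}$ on which $1_{K_A}\otimes1_{K_B}$ equals $1$. $K_A\dot\otimes K_B=\operatorname{conv}\{x_A\otimes x_B:x_A\in K_A,x_B\in K_B\}$. $\operatorname{Ext}_n(K_A,K_B)$ is the set of $x_{AB}\in K_A\hat\otimes K_B$ possessing an $n$-extension, i.e. some $y_{AB^n}\in K_A\hat\otimes K_B^{\hat\otimes n}$ invariant under all permutations of the $n$ $B$-factors with $x_{AB}=(\mathrm{id}_A\otimes\mathrm{id}_B\otimes1_{K_B}^{\otimes(n-1)})(y_{AB^n})$.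 Constraints: $F_A:A(K_A)^\star\to U_A$, $F_B:A(K_B)^\star\to U_B$ are linear maps into finite-dimensional real vector spaces; $G_A:A(K_A)^\star\to W_A$, $G_B:A(K_B)^\star\to W_B$ are linear maps into finite-dimensional ordered real vector spaces (ordered by proper cones). Inequalities for elements of tensor products refer to the maximal tensor product of the positive cones of the factors. $\Sigma^n(A:B)$ is the set of $x_{AB}\in\operatorname{Ext}_n(K_A,K_B)$ having an $n$-extension $y_{AB^n}$ (i.e. some $y_{AB^n}\in K_A\hat\otimes K_B^{\hat\otimes n}$ invariant under all permutations of the $n$ $B$-factors with $x_{AB}=(\mathrm{id}_A\otimes\mathrm{id}_B\otimes1_{K_B}^{\otimes(n-1)})(y_{AB^n})$) which in addition satisfies (a) $(F_A\otimes\mathrm{id}_{B^n})(y_{AB^n})=0$; (b) $(\mathrm{id}_A\otimes F_B\otimes\mathrm{id}_{B^{n-1}})(y_{AB^n})=0$; (c) $(G_A\otimes\mathrm{id}_{B^n})(y_{AB^n})\ge0$; (d) $(\mathrm{id}_A\otimes G_B\otimes\mathrm{id}_{B^{n-1}})(y_{AB^n})\ge0$. The problem defining $p^*$ is assumed feasible. A measurement $\mathcal M_B:K_B\to\Delta$ with finite outcome set $\Omega$ is an affine map into the simplex of probability distributions on $\Omega$, given by effects $\{M^z\}_{z\in\Omega}\subseteq E(K_B)$ with $\sum_zM^z=1_{K_B}$; it is informationally complete if it is injective on $K_B$. ''Explicitly constructible'' means: for some $m\in\{0,\dots,n-1\}$, $$w^{(n)}_{AB}=\sum_{z^m\in\Omega^m}p(z^m)\,x_{A|z^m}\otimes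 x_{B_{m+1}|z^m},$$ where $p(z^m)$ is the probability of outcome $z^m=(z_1,\dots,z_m)$ when $\mathcal M_B$ is applied to the first $m$ $B$-factors of $y^{(n)}_{AB^n}$, and $x_{A|z^m}$, $x_{B_{m+1}|z^m}$ are the normalized conditional states of $A$ and of the $(m+1)$-st $B$-factor: they are obtained from $y^{(n)}_{AB^n}$ by applying $M^{z_1}\otimes\dots\otimes M^{z_m}$ to the first $m$ $B$-factors and unit functionals to all other factors except the retained one, and dividing by $p(z^m)$ (terms with $p(z^m)=0$ are omitted). Norms: for $f\in A(K)$, $\|f\|_{1_K}=\inf\{t\ge0:-t1_K\le f\le t1_K\}$; for $\phi\in A(K)^\star$, $\|\phi\|_{\star,1_K}=\sup\{|\langle\phi,g\rangle|:\|g\|_{1_K}\le1\}$. $P$ is regarded as an element of $A(K_A\hat\otimes K_B)\cong A(K_A)\otimes A(K_B)$, with $1_{K_A\hat\otimes K_B}=1_{K_A}\otimes1_{K_B}$. *)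

(* Defs.v *)
From HB Require Import structures.
From mathcomp Require Import all_boot all_order all_algebra perm.
From mathcomp Require Import all_classical all_reals all_analysis.

Set Implicit Arguments.
Unset Strict Implicit.
Unset Printing Implicit Defensive.

Import Order.TTheory GRing.Theory Num.Theory.
Import numFieldNormedType.Exports.

Local Open Scope classical_set_scope.
Local Open Scope ring_scope.

(* The topology of a finite-dimensional real vector space is read through the
   coordinates in a basis; it does not depend on the choice of the basis. *)
Definition fd_compact (R : realType) (V : vectType R) (K : set V) : Prop :=
  compact [set passmx.rVof (vbasis {:V}) x | x in K].

Definition fd_closed (R : realType) (V : vectType R) (C : set V) : Prop :=
  closed [set passmx.rVof (vbasis {:V}) x | x in C].

Record stateSpace (R : realType) (V : vectType R) := StateSpace {
  ss_set :> set V;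
  ss_nonempty : ss_set !=set0;
  ss_convex : convex_set (ss_set : set (convex_lmodType V));
  ss_compact : fd_compact ss_set
}.

Record properCone (R : realType) (W : vectType R) := ProperCone {
  pc_set :> set W;
  pc_add : forall a b, pc_set a -> pc_set b -> pc_set (a + b);
  pc_scale : forall (t : R) a, 0 <= t -> pc_set a -> pc_set (t *: a);
  pc_closed : fd_closed pc_set;
  pc_pointed : forall a, pc_set a -> pc_set (- a) -> a = 0;
  pc_generating : forall a, exists b c, [/\ pc_set b, pc_set c & a = b - c]
}.

Section AffineFunctions.
Context {R : realType} {V : vectType R}.

Definition is_affine (K : stateSpace V) (f : K -> R^o) : Prop :=
  forall (x y z : K) (t : R), 0 <= t <= 1 ->
    val z = t *: val x + (1 - t) *: val y ->
    f z = t * f x + (1 - t) * f y.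

Definition affine_pred (K : stateSpace V) : {pred K -> R^o} :=
  fun f => `[< is_affine f >].

Lemma affine_submod (K : stateSpace V) : submod_closed (@affine_pred K).
Proof.
split=> [|a f g].
  by apply: asboolT => x y z t _ _; rewrite !mulr0 addr0.
move=> /asboolW hf /asboolW hg; apply: asboolT => x y z t t01 e.
rewrite /GRing.add /GRing.scale /= (hf _ _ _ _ t01 e) (hg _ _ _ _ t01 e).
by rewrite /GRing.scale /= !mulrDr !mulrA ![_ * a]mulrC addrACA.
Qed.

HB.instance Definition _ (K : stateSpace V) :=
  GRing.isSubmodClosed.Build R (K -> R^o) (@affine_pred K) (@affine_submod K).

(* The space A(K). *)
Record aff (K : stateSpace V) := Aff {
  aff_fun :> K -> R^o;
  aff_funP : aff_fun \in @affine_pred K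
}.

HB.instance Definition _ (K : stateSpace V) := [isSub for @aff_fun K].
HB.instance Definition _ (K : stateSpace V) := [Choice of aff K by <:].
HB.instance Definition _ (K : stateSpace V) :=
  [SubChoice_isSubZmodule of aff K by <:].
HB.instance Definition _ (K : stateSpace V) :=
  [SubZmodule_isSubLmodule of aff K by <:].


Lemma aff_affine (K : stateSpace V) (f : aff K) : is_affine f.
Proof. exact: (asboolW (aff_funP f)). Qed.

Lemma affP (K : stateSpace V) (f g : aff K) : f =1 g -> f = g.
Proof. by move=> fg; apply/val_inj/funext. Qed.

Lemma ss_point (K : stateSpace V) : K.
Proof. by have [x Kx] := cid (ss_nonempty K); exists x; rewrite inE. Qed.

Lemma ss_conv (K : stateSpace V) (x y : K) (t : R) : 0 <= t <= 1 ->
  exists z : K, val z = t *: val x + (1 - t) *: val y.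
Proof.
move=> /andP[t0 t1].
have t01 : Itv.spec (@Itv.num_sem R) (Itv.Real `[0%Z, 1%Z]) t.
  by rewrite /Itv.spec /Itv.num_sem /= in_itv /= t0 t1 ger0_real.
have := @ss_convex R V K (val x) (val y) (Itv.mk t01) (valP x) (valP y).
by move=> Kz; exists (@exist V (fun z => z \in ss_set K) _ Kz).
Qed.

Lemma aff_comb (K : stateSpace V) (f : aff K) (r : seq (R * K)) :
  all (fun p => 0 <= p.1) r ->
  exists z : K,
    (\sum_(p <- r) p.1) *: val z = \sum_(p <- r) p.1 *: val p.2 /\
    (\sum_(p <- r) p.1) * f z = \sum_(p <- r) p.1 * f p.2.
Proof.
elim: r => [_|[a x] r IH /= /andP[a0 r0]].
  by exists (ss_point K); rewrite !big_nil scale0r mul0r.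
have [z' [e1 e2]] := IH r0; rewrite !big_cons /= -e1 -e2.
set s' := \sum_(p <- r) p.1.
have s'0 : 0 <= s' by rewrite /s' big_seq sumr_ge0// => p /(allP r0).
have [s0|s0] := eqVneq (a + s') 0.
  move/eqP: (s0); rewrite paddr_eq0// => /andP[/eqP-> /eqP->].
  by exists z'; rewrite !add0r !scale0r !mul0r !addr0.
have sp : 0 < a + s' by rewrite lt_def s0 addr_ge0.
have t01 : 0 <= a / (a + s') <= 1.
  by rewrite divr_ge0 ?(ltW sp)//= ler_pdivrMr// mul1r lerDl.
have et : 1 - a / (a + s') = s' / (a + s').
  by rewrite -{1}(divff s0) -mulrBl addrC addKr.
have q u : (a + s') * (u / (a + s')) = u by rewrite mulrC divfK.
have [z ez] := ss_conv x z' t01; exists z; split.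
  by rewrite ez et scalerDr !scalerA !q.
by rewrite (aff_affine f t01 ez) et mulrDr (mulrA _ (a / _)) (mulrA _ (s' / _)) !q.
Qed.

Definition homog (x : V) : V * R^o := (x, 1).

Lemma homog_sum (T : Type) (r : seq T) (a : T -> R) (g : T -> V) :
  \sum_(p <- r) a p *: homog (g p) =
    (\sum_(p <- r) a p *: g p, \sum_(p <- r) a p).
Proof.
elim: r => [|p r IH]; first by rewrite !big_nil.
by rewrite !big_cons IH; congr pair; rewrite /= /GRing.scale /= mulr1.
Qed.

Lemma maximal_span (T : Type) (W : vectType R) (h : T -> W) :
  exists s : seq T, forall x, h x \in <<[seq h y | y <- s]>>%VS.
Proof.
pose P (d : nat) := `[< exists s, \dim <<[seq h y | y <- s]>> = d >].
have P0 : exists d, P d.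
  by exists 0%N; apply: asboolT; exists [::]; rewrite span_nil dimv0.
have Pb d : P d -> (d <= \dim {: W})%N.
  by move=> /asboolW[s <-]; apply: dimvS; exact: subvf.
case: (ex_maxnP P0 Pb) => d /asboolW[s sd] maxd; exists s => x.
have := maxd _ (asboolT (ex_intro _ (x :: s) erefl)).
rewrite -sd /= => le.
have /eqP -> : <<[seq h y | y <- s]>>%VS == <<h x :: [seq h y | y <- s]>>%VS.
  by rewrite eqEdim le andbT span_cons addvSr.
by rewrite memv_span// mem_head.
Qed.

Lemma aff_eq0 (K : stateSpace V) (s : seq K) (f : aff K) :
  (forall x : K, homog (val x) \in <<[seq homog (val y) | y <- s]>>%VS) ->
  (forall y, y \in s -> f y = 0) -> f = 0.
Proof.
move=> sp f0; apply: affP => x; change (f x = 0).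
pose xt := in_tuple [seq homog (val y) | y <- s].
have /coord_span ex : homog (val x) \in <<xt>>%VS by exact: sp.
pose c i : R := coord xt i (homog (val x)).
have sz i : (i < size [seq homog (val y) | y <- s])%N -> (i < size s)%N.
  by rewrite size_map.
pose pt (i : 'I_(size [seq homog (val y) | y <- s])) := nth x s i.
have ept (i : 'I__) : xt`_i = homog (val (pt i)).
  by rewrite /xt /= (nth_map x)// sz.
have exc : homog (val x) = \sum_i c i *: homog (val (pt i)).
  by rewrite {1}ex; apply: eq_bigr => i _; rewrite -ept.
rewrite homog_sum in exc.
have e1 : val x = \sum_i c i *: val (pt i) by case: exc.
have e2 : 1 = \sum_i c i by case: exc.
pose cp i := Num.max (c i) 0; pose cn i := Num.max (- c i) 0.
have ecc i : c i = cp i - cn i.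
  rewrite /cp /cn; case: (lerP (c i) 0) => h.
    by rewrite max_l ?oppr_ge0// opprK add0r.
  by rewrite max_r ?oppr_le0 ?ltW// subr0.
pose I := index_enum 'I_(size [seq homog (val y) | y <- s]).
pose rp := [seq (cp i, pt i) | i <- I].
pose rn := (1, x) :: [seq (cn i, pt i) | i <- I].
have [|z1 [a1 b1]] := @aff_comb K f rp.
  by apply/allP => _ /mapP[i _ ->] /=; rewrite le_max lexx orbT.
have [|z2 [a2 b2]] := @aff_comb K f rn.
  by rewrite /= ler01; apply/allP => _ /mapP[i _ ->] /=; rewrite le_max lexx orbT.
move: a1 b1 a2 b2; rewrite /rn !big_cons !big_map /=.
set sp1 := \sum_(i <- I) cp i; set sn1 := \sum_(i <- I) cn i => a1 b1 a2 b2.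
have es : sp1 = 1 + sn1.
  rewrite e2 /sp1 /sn1 -big_split /=.
  by apply: eq_bigr => i _; rewrite ecc subrK.
have ev : \sum_(i <- I) cp i *: val (pt i) =
          1 *: val x + \sum_(i <- I) cn i *: val (pt i).
  rewrite scale1r e1 -big_split /=.
  by apply: eq_bigr => i _; rewrite ecc -scalerDl subrK.
have sn0 : 0 <= sn1 by apply: sumr_ge0 => i _; rewrite le_max lexx orbT.
have s0 : sp1 != 0 by rewrite es gt_eqF// ltr_wpDr.
have ez : z1 = z2.
  by apply/val_inj/(scalerI s0); rewrite a1 es a2 ev.
have fpt i : f (pt i) = 0 by apply: f0; apply: mem_nth; exact: sz.
move: b1; rewrite big1; last by move=> i _; rewrite fpt mulr0.
move: b2; rewrite [in X in _ = _ + X -> _]big1; last by move=> i _; rewrite fpt mulr0.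
by rewrite -es ez addr0 mul1r => -> ->.
Qed.

Lemma injective_vect_axiom (L : lmodType R) n (ev : {linear L -> 'rV[R]_n}) :
  injective ev -> exists m, inhabited (Vector.axiom m L).
Proof.
move=> ev_inj.
have [s] := maximal_span ev; set U := <<[seq ev y | y <- s]>>%VS => evU.
have Uev u : u \in U -> exists x, ev x = u.
  rewrite /U; elim: s {U evU} u => [u|y s IH u].
    by rewrite span_nil memv0 => /eqP ->; exists 0; rewrite linear0.
  rewrite /= span_cons => /memv_addP[a /vlineP[k ->] [b /IH[x <-] ->]].
  by exists (k *: y + x); rewrite linearD linearZ.
pose X := vbasis U.
pose h (x : L) : 'rV[R]_(\dim U) := \row_i coord X i (ev x).
have h_lin : linear h.
  by move=> a x y; apply/rowP => i; rewrite !mxE !linearP.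
have hK x : \sum_i h x 0 i *: X`_i = ev x.
  rewrite [RHS](coord_vbasis (evU x)); apply: eq_bigr => i _.
  by rewrite mxE.
have h_inj : injective h by move=> x y e; apply: ev_inj; rewrite -!hK e.
have h_surj r : exists x, h x = r.
  have /Uev[x ex] : \sum_i r 0 i *: X`_i \in U.
    by apply: memv_suml => i _; apply/memvZ/vbasis_mem/memt_nth.
  exists x; apply/rowP => i; rewrite mxE ex.
  rewrite linear_sum /= (bigD1 i)//= linearZ /= coord_free ?(basis_free (vbasisP U))//.
  rewrite eqxx mulr1 big1 ?addr0// => j ji.
  rewrite linearZ /= coord_free ?(basis_free (vbasisP U))//.
  by rewrite (_ : (_ == _) = false) ?mulr0//; apply: negbTE ji.
exists (\dim U); constructor; exists h => //.
exists (fun r => projT1 (cid (h_surj r))).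
  by move=> x; apply: h_inj; case: cid.
by move=> r; case: cid.
Qed.

Lemma aff_fin_dim (K : stateSpace V) :
  exists m, inhabited (Vector.axiom m (aff K)).
Proof.
have [s sp] := maximal_span (fun x : K => homog (val x)).
pose ev (f : aff K) : 'rV[R]_(size s) := \row_i f (tnth (in_tuple s) i).
have ev_lin : linear ev by move=> a f g; apply/rowP => i; rewrite !mxE.
pose evL := HB.pack_for {linear aff K -> 'rV[R]_(size s)} ev
  (GRing.isLinear.Build R (aff K) 'rV[R]_(size s) _ ev ev_lin).
apply: (@injective_vect_axiom _ _ evL).
apply: raddf_inj => f e; apply: (aff_eq0 sp) => y ys.
have /rowP/(_ (Ordinal (eq_ind_r is_true ys (index_mem y s)))) := e.
by rewrite !mxE (tnth_nth y) /= nth_index.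
Qed.

Definition aff_dim (K : stateSpace V) : nat := projT1 (cid (aff_fin_dim K)).

Lemma aff_vect_axiom (K : stateSpace V) : Vector.axiom (aff_dim K) (aff K).
Proof. exact: (inhabited_witness (projT2 (cid (aff_fin_dim K)))). Qed.

HB.instance Definition _ (K : stateSpace V) :=
  Lmodule_hasFinDim.Build R (aff K) (aff_vect_axiom K).

End AffineFunctions.

Arguments aff {R V} K.

Definition dual (R : realType) (W : vectType R) := 'Hom(W, R^o).

Definition dual_cone (R : realType) (W : vectType R) (C : set W) :
    set (dual W) :=
  [set h | forall a, C a -> (0 : R) <= h a].

Section StateSpaces.
Context {R : realType} {V : vectType R} (K : stateSpace V).

Lemma one_affine : (fun=> 1 : R^o) \in @affine_pred R V K.
Proof. by apply: asboolT => x y z t _ _; rewrite !mulr1 subrKC. Qed.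

Definition aff1 : aff K := Aff one_affine.

Definition aff_ge0 : set (aff K) := [set f | forall x : K, (0 : R) <= f x].

Definition effects : set (aff K) :=
  [set f | aff_ge0 f /\ aff_ge0 (aff1 - f)].

(* K, as a subset of the dual of A(K). *)
Definition states : set (dual (aff K)) :=
  [set phi | dual_cone aff_ge0 phi /\ phi aff1 = 1].

Definition is_measurement (Omega : finType) (M : Omega -> aff K) : Prop :=
  (forall z, effects (M z)) /\ \sum_z M z = aff1.

(* Injectivity on K of the map into the simplex given by the effects M. *)
Definition info_complete (Omega : finType) (M : Omega -> aff K) : Prop :=
  forall x y : K, (forall z, M z x = M z y) -> x = y.

Record constraints := Constraints {
  cstr_U : vectType R;
  cstr_F : 'Hom(dual (aff K), cstr_U);
  cstr_W : vectType R;
  cstr_C : properCone cstr_W;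
  cstr_G : 'Hom(dual (aff K), cstr_W)
}.

Definition constrained (c : constraints) : set (dual (aff K)) :=
  [set x | [/\ states x, cstr_F c x = 0 & pc_set (cstr_C c) (cstr_G c x)]].

End StateSpaces.

Arguments aff1 {R V} K.
Arguments aff_ge0 {R V} K.
Arguments states {R V} K.

Definition conv_hull (R : realType) (T : vectType R) (S : set T) : set T :=
  [set x | exists (N : nat) (p : 'I_N -> R) (a : 'I_N -> T),
     [/\ forall i, 0 <= p i, \sum_i p i = 1, forall i, S (a i) &
         x = \sum_i p i *: a i]].

(* For a convex set S of states spanning T, linear functionals on T are the
   affine functions on S; these are the order-unit norm of A(S), with the
   constant 1 as unit, and its dual norm on T. *)
Definition unit_norm (R : realType) (T : vectType R) (S : set T)
    (g : dual T) : R :=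
  inf [set t : R | 0 <= t /\ (forall x, S x -> - t <= g x <= t)].

Definition dual_unit_norm (R : realType) (T : vectType R) (S : set T)
    (phi : T) : R :=
  sup [set (`|g phi| : R) | g in [set g : dual T | unit_norm S g <= 1]].

Definition is_minimum (R : realType) (S : set R) (p : R) : Prop :=
  S p /\ forall q, S q -> p <= q.

Definition is_minimizer (R : realType) (T : vectType R) (P : dual T)
    (S : set T) (x : T) : Prop :=
  S x /\ forall x', S x' -> P x <= P x' :> R.

Section Tensors.
Context {R : realType} {VA VB : vectType R}.
Context (KA : stateSpace VA) (KB : stateSpace VB).

(* Tensor products with duals of finite-dimensional spaces are spaces of
   multilinear maps: A(KA)^* (x) A(KB)^* is the space of bilinear forms on
   A(KA) x A(KB), with (f (x) g)(x) = x f g. *)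
Definition bitens := 'Hom(aff KA, 'Hom(aff KB, R^o)).

Definition ptens (xA : dual (aff KA)) (xB : dual (aff KB)) : bitens :=
  linfun (fun f => (xA f : R) *: xB).

(* The dual of the cone A(K)^{*+} is A(K)^+, so maximality is tested on
   products of nonnegative affine functions. *)
Definition max_states : set bitens :=
  [set x : bitens |
     (forall f g, aff_ge0 KA f -> aff_ge0 KB g -> (0 : R) <= x f g) /\
     x (aff1 KA) (aff1 KB) = 1].

Definition product_states (SA : set (dual (aff KA)))
    (SB : set (dual (aff KB))) : set bitens :=
  [set x : bitens | exists xA xB, [/\ SA xA, SB xB & x = ptens xA xB]].

Definition sep_states : set bitens :=
  conv_hull (product_states (states KA) (states KB)).

(* Elements of A(KA)^* (x) (A(KB)^* )^{(x) n} are the [multilinear] ones. *)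
Definition mform n := aff KA -> ('I_n -> aff KB) -> R^o.

Definition set_slot n (gs : 'I_n -> aff KB) (i : 'I_n) (g : aff KB) :
    'I_n -> aff KB :=
  fun j => if j == i then g else gs j.

Definition multilinear n (y : mform n) : Prop :=
  (forall gs, linear (fun f => y f gs)) /\
  (forall f gs i, linear (fun g => y f (set_slot gs i g))).

(* gs in the first B-slots, and the unit in the remaining ones. *)
Definition slots n (gs : seq (aff KB)) : 'I_n -> aff KB :=
  fun i => nth (aff1 KB) gs i.

(* Testing on products of functionals is the iterated binary maximal tensor
   product in any bracketing: for h in the dual of the maximal product of the
   last factors, (f (x) h)(y) = h((f (x) id)(y)). *)
Definition max_states_n n (y : mform n) : Prop :=
  [/\ multilinear y,
      forall f gs, aff_ge0 KA f -> (forall i, aff_ge0 KB (gs i)) ->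
        (0 : R) <= y f gs &
      y (aff1 KA) (slots [::]) = 1].

Definition symmetric n (y : mform n) : Prop :=
  forall (s : 'S_n) f gs, y f (gs \o s) = y f gs.

Definition is_extension n (x : bitens) (y : mform n) : Prop :=
  [/\ max_states_n y, symmetric y &
      forall f g, x f g = y f (slots [:: g])].

Definition Ext n : set bitens :=
  [set x : bitens | max_states x /\ exists y : mform n, is_extension x y].

(* L (x) id, as a multilinear map with values in the codomain of L. *)
Definition tensA n (U : vectType R) (L : 'Hom(dual (aff KA), U)) (y : mform n)
    (gs : 'I_n -> aff KB) : U :=
  L (linfun (fun f => y f gs)).

(* id (x) L (x) id with L on the first B-factor: gs i is ignored for i = 0. *)
Definition tensB n (U : vectType R) (L : 'Hom(dual (aff KB), U)) (y : mform n)
    (f : aff KA) (gs : 'I_n -> aff KB) : U :=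
  L (linfun (fun g => y f (fun i => if val i == 0%N then g else gs i))).

Definition satisfies_constraints n (cA : constraints KA) (cB : constraints KB)
    (y : mform n) : Prop :=
  [/\ forall gs, tensA (cstr_F cA) y gs = 0,
      forall f gs, tensB (cstr_F cB) y f gs = 0,
      forall (h : dual (cstr_W cA)) gs,
        dual_cone (cstr_C cA) h -> (forall i, aff_ge0 KB (gs i)) ->
        (0 : R) <= h (tensA (cstr_G cA) y gs) &
      forall (h : dual (cstr_W cB)) f gs,
        dual_cone (cstr_C cB) h -> aff_ge0 KA f ->
        (forall i, aff_ge0 KB (gs i)) ->
        (0 : R) <= h (tensB (cstr_G cB) y f gs)].

Definition is_Sigma_extension n (cA : constraints KA) (cB : constraints KB)
    (x : bitens) (y : mform n) : Prop :=
  is_extension x y /\ satisfies_constraints cA cB y.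

Definition Sigma n (cA : constraints KA) (cB : constraints KB) : set bitens :=
  [set x : bitens | Ext n x /\ exists y : mform n, is_Sigma_extension cA cB x y].

Section Measured.
Context (Omega : finType) (M : Omega -> aff KB) (n : nat) (y : mform n).

Definition outcome_prob m (z : m.-tuple Omega) : R :=
  y (aff1 KA) (slots (map M z)).

Definition cond_stateA m (z : m.-tuple Omega) : dual (aff KA) :=
  (outcome_prob z)^-1 *: linfun (fun f => y f (slots (map M z))).

Definition cond_stateB m (z : m.-tuple Omega) : dual (aff KB) :=
  (outcome_prob z)^-1 *:
    linfun (fun g => y (aff1 KA) (slots (rcons (map M z) g))).

Definition explicitly_constructible (w : bitens) : Prop :=
  exists2 m : nat, (m < n)%N &
    w = \sum_(z : m.-tuple Omega | outcome_prob z != 0)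
          outcome_prob z *: ptens (cond_stateA z) (cond_stateB z).

End Measured.

End Tensors.

Arguments max_states {R VA VB} KA KB.
Arguments sep_states {R VA VB} KA KB.
Arguments Ext {R VA VB} KA KB n.

(* Main.v *)
Require Import Defs.
From HB Require Import structures.
From mathcomp Require Import all_boot all_order all_algebra perm.
From mathcomp Require Import all_classical all_reals all_analysis.
From mathcomp Require Import ring lra.

Set Implicit Arguments.
Unset Strict Implicit.
Unset Printing Implicit Defensive.

Import Order.TTheory GRing.Theory Num.Theory.
Import numFieldNormedType.Exports.

Local Open Scope classical_set_scope.
Local Open Scope ring_scope.

(** Let y be the n-extension of x.  Measuring its B-factors one after the other
with a measurement M turns the state of A into a bounded martingale: for every
effect f on A, the conditional expectation a(z) = y(f, M^z) / p(z), indexed by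
the outcome string z.  The increments of a martingale are orthogonal, so the
expected squares of its n successive increments add up to at most 1; summed over
the effects f of a measurement on A, they add up to a constant independent of n.
Hence some step m < n changes the state of A by O(1/sqrt n) in mean
([some_step_is_predictable]): given the first m outcomes, the next outcome is
nearly independent of A.  The mixture w of the products of conditional states
after m outcomes therefore agrees with x up to O(1/sqrt n) on every product of
an effect of the measurement on A and an effect of M
([measured_mixture_close]).  This second-moment argument takes the place of
the usual one by mutual information and the Pinsker inequality, and gives the
same rate.

Both measurements are chosen so that their effects span the spaces of affine
functions ([exists_spanning_measurement]).  Then M is injective on states, and
agreement on finitely many products controls the dual norm
([dual_unit_norm_le]), at the price of a constant that depends only on the two
state spaces.

The conditional states inherit the constraints from y
([cond_stateA_constrained], [cond_stateB_constrained]).  The linear ones are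
immediate; the conic ones hold when tested on the dual cone, hence hold by the
bipolar theorem ([cone_bipolar]); the constraint on B, imposed on the first
B-factor, reaches the retained factor by symmetry.  So P(w) is at least the
optimum pstar.  Conversely a product of optimal states has a symmetric product
extension ([power_form_Sigma]), so P(x) is at most pstar, and P(w) - pstar is
bounded by P(w - x), to which the duality of the norms applies
([dual_unit_norm_holder]).  The optimum is attained because the constrained
states form a compact set ([constrained_compact]). *)

(** * Affine functions and spanning measurements *)

Lemma big_option (R : nmodType) (T : finType) (F : option T -> R) :
  \sum_z F z = F None + \sum_i F (Some i).
Proof.
rewrite (bigD1 None)//= (reindex_omap Some id) => [|[i|]//].
by congr (_ + _); apply: eq_bigl => i; rewrite eqxx.
Qed.

Section Frame.
Context {R : realType} {V : vectType R}.

Lemma mx_norm_coord n (v : 'rV[R]_n) i : `|v 0 i| <= `|v|.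
Proof.
rewrite [leRHS]mx_normrE.
exact: (le_bigmax _ (fun ij : 'I_1 * 'I_n => `|v ij.1 ij.2|) (0, i)).
Qed.

(** [linfun] is meaningful only on linear functions; this unfolds it without
declaring each of them as a structure. *)
Lemma linfun_linearE (W U : vectType R) (f : W -> U) : linear f -> linfun f =1 f.
Proof.
move=> lf.
pose fL := HB.pack_for {linear W -> U} f (GRing.isLinear.Build R W U _ f lf).
exact: (lfunE fL).
Qed.

Lemma aff_addE (K : stateSpace V) (f g : aff K) x : (f + g) x = f x + g x.
Proof. by []. Qed.
Lemma aff_subE (K : stateSpace V) (f g : aff K) x : (f - g) x = f x - g x.
Proof. by []. Qed.
Lemma aff_scaleE (K : stateSpace V) (a : R) (f : aff K) x :
  (a *: f) x = a * f x.
Proof. by []. Qed.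
Lemma aff_sumE (K : stateSpace V) (I : Type) (r : seq I) (P : pred I)
    (F : I -> aff K) x :
  (\sum_(i <- r | P i) F i) x = \sum_(i <- r | P i) F i x.
Proof. by elim/big_rec2: _ => //= i y f _ <-. Qed.

(** A maximal free family of lifted points spans all the others; it is an
affine basis of the affine hull of K. *)
Lemma free_homog_span (K : stateSpace V) :
  exists2 s : seq K, free [seq homog (val y) | y <- s] &
    forall x : K, homog (val x) \in <<[seq homog (val y) | y <- s]>>%VS.
Proof.
pose h (x : K) := homog (val x).
pose P n := `[< exists2 s : seq K, free (map h s) & size s = n >].
have P0 : exists n, P n.
  by exists 0%N; apply: asboolT; exists [::] => //; exact: nil_free.
have Pb n : P n -> (n <= \dim {: (V * R^o)%type})%N.
  move=> /asboolW[s fs <-].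
  by rewrite -(size_map h) -(eqP fs) dimvS// subvf.
case: (ex_maxnP P0 Pb) => n /asboolW[s fs sn] maxn; exists s => // x.
apply: contraT => xs.
have /maxn : P n.+1.
  by apply: asboolT; exists (x :: s); [rewrite /= free_cons xs|rewrite /= sn].
by rewrite ltnn.
Qed.

Lemma is_affine_linear (K : stateSpace V) (l : 'Hom((V * R^o)%type, R^o)) :
  (fun x : K => l (homog (val x))) \in @affine_pred R V K.
Proof.
apply: asboolT => x y z t _ e.
have -> : homog (val z) = t *: homog (val x) + (1 - t) *: homog (val y).
  by rewrite /homog e; congr pair; rewrite /= /GRing.scale /= !mulr1 addrC subrK.
by rewrite linearD !linearZ.
Qed.

(** Compactness of K is stated in the coordinates of a basis, so the bound
comes from the expansion of the point in that basis. *)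
Lemma linear_bounded (K : stateSpace V) (l : 'Hom((V * R^o)%type, R^o)) :
  exists B : R, forall x : K, `|l (homog (val x)) : R| <= B.
Proof.
have [M [_ hM]] := @compact_bounded R _ [set passmx.rVof (vbasis {:V}) x | x in
  ss_set K] (@ss_compact R V K).
pose e := vbasis {:V}.
exists (\sum_(i < \dim {:V}) (M + 1) * `|l (e`_i, 0) : R| + `|l (0, 1) : R|) => x.
have -> : homog (val x) = (\sum_(i < \dim {:V}) coord e i (val x) *: (e`_i, 0))
  + (0, 1).
  have {1}-> : val x = \sum_(i < \dim {:V}) coord e i (val x) *: e`_i.
    by apply: coord_vbasis; exact: memvf.
  rewrite /homog; elim/big_rec2: _ => [|i u v _ IH].
    by congr pair; rewrite /= add0r.
  rewrite -addrA -IH; congr pair => /=.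
  by rewrite scaler0 add0r.
rewrite linearD linear_sum (le_trans (ler_normD _ _))// lerD2r.
rewrite (le_trans (ler_norm_sum _ _ _))// ler_sum// => i _.
rewrite linearZ normrM ler_wpM2r//.
have M1 : M < M + 1 by rewrite ltrDl.
have := hM _ M1 (passmx.rVof e (val x)) (ex_intro2 _ _ _ (set_mem (valP x)) erefl).
apply: le_trans; rewrite passmx.coord_rVof.
exact: mx_norm_coord.
Qed.

(** The c i are the barycentric coordinates with respect to an affine basis s
of K: an affine function is the combination of its values at the s i. This
makes an affine function on K the restriction of a linear functional on the
ambient space, and hence bounded. *)
Lemma aff_frame (K : stateSpace V) :
  exists (d : nat) (s : 'I_d -> K) (c : 'I_d -> aff K),
    (forall i, exists B : R, forall x, `|c i x : R| <= B) /\
    (forall f : aff K, f = \sum_i (f (s i) : R) *: c i).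
Proof.
have [s fs sps] := free_homog_span K.
pose x0 := ss_point K.
pose X := in_tuple [seq homog (val y) | y <- s].
have sz : size [seq homog (val y) | y <- s] = size s by rewrite size_map.
pose t (i : 'I_(size [seq homog (val y) | y <- s])) := nth x0 s i.
have Xt (i : 'I__) : X`_i = homog (val (t i)).
  by rewrite /X /= (nth_map x0) // -[X in (_ < X)%N]sz.
have lcoord i : linear (coord X i : _ -> R^o) by move=> a u v; rewrite linearP.
pose c i : aff K := Aff (is_affine_linear K (linfun (coord X i : _ -> R^o))).
have cE i x : c i x = coord X i (homog (val x)) by rewrite /= linfun_linearE.
exists _, t, c; split=> [i|f].
  have [B hB] := linear_bounded K (linfun (coord X i : _ -> R^o)).
  by exists B.
apply/eqP; rewrite -subr_eq0; apply/eqP; apply: (aff_eq0 sps) => y ys.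
have ji : (index y s < size [seq homog (val y) | y <- s])%N.
  by rewrite sz index_mem.
pose j := Ordinal ji.
have ty : t j = y by rewrite /t nth_index.
rewrite -ty aff_subE aff_sumE (bigD1 j isT) big1 => [|i ij].
  by rewrite aff_scaleE cE -Xt coord_free// eqxx mulr1 /= addr0 subrr.
by rewrite aff_scaleE cE -Xt coord_free// (_ : (_ == _) = false) ?mulr0//;
  apply: negbTE; rewrite eq_sym.
Qed.

Lemma aff_bounded (K : stateSpace V) (f : aff K) :
  exists2 B : R, 0 < B & forall x, `|f x : R| <= B.
Proof.
have [d [s [c [cB fE]]]] := aff_frame K.
have [B hB] := choice cB.
exists (1 + \sum_i `|f (s i) : R| * `|B i|).
  by rewrite ltr_pwDl// sumr_ge0.
move=> x; rewrite {1}(fE f) aff_sumE (le_trans (ler_norm_sum _ _ _))//.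
apply: (@le_trans _ _ (\sum_i `|f (s i) : R| * `|B i|)); last by rewrite lerDr.
apply: ler_sum => i _; rewrite aff_scaleE normrM ler_wpM2l//.
by rewrite (le_trans (hB i x)) ?ler_norm.
Qed.

Lemma aff_separates (K : stateSpace V) (x y : K) :
  (forall f : aff K, f x = f y) -> x = y.
Proof.
move=> fxy; apply: val_inj.
have lin i : linear (fun u : V * R^o => coord (vbasis {:V}) i u.1 : R^o).
  by move=> a u v; rewrite linearP.
rewrite [LHS](coord_vbasis (memvf _)) [RHS](coord_vbasis (memvf _)).
apply: eq_bigr => i _; congr (_ *: _).
have := fxy (Aff (is_affine_linear K
  (linfun (fun u : V * R^o => coord (vbasis {:V}) i u.1 : R^o)))).
by rewrite /= !linfun_linearE.
Qed.

Definition spanning (K : stateSpace V) (Omega : finType) (M : Omega -> aff K) :=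
  forall f : aff K, exists b : Omega -> R, f = \sum_z b z *: M z.

Lemma spanning_info_complete (K : stateSpace V) (Omega : finType)
    (M : Omega -> aff K) : spanning M -> info_complete M.
Proof.
move=> spM x y Mxy; apply: aff_separates => f.
have [b ->] := spM f; rewrite !aff_sumE; apply: eq_bigr => z _.
by rewrite !aff_scaleE Mxy.
Qed.

(** Shift and rescale the barycentric coordinates so that they take values in
the interval from 0 to 1/(d+1); their sum then stays below 1, and its
complement to 1 is the last effect. The sum of the effects recovers the
constant 1, and with it the original coordinates. *)
Lemma exists_spanning_measurement (K : stateSpace V) :
  exists (Omega : finType) (M : Omega -> aff K),
    is_measurement M /\ spanning M.
Proof.
have [d [s [c [cB cspan]]]] := aff_frame K.
have [B hB] := choice (fun i => let: ex_intro2 B B0 hB := aff_bounded (c i) in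
  ex_intro (fun B : R => 0 < B /\ forall x, `|c i x : R| <= B) B (conj B0 hB)).
pose D : R := d.+1%:R.
have D0 : 0 < D by rewrite ltr0n.
(* D = d + 1 rather than d, so that it is invertible when d = 0. *)
pose m i : aff K := (2 * B i * D)^-1 *: (c i + B i *: aff1 K).
pose M (z : option 'I_d) : aff K :=
  if z is Some i then m i else aff1 K - \sum_i m i.
have BD i : 0 < 2 * B i * D by rewrite !mulr_gt0// (hB i).1.
have mE i x : m i x = (2 * B i * D)^-1 * (c i x + B i) :> R.
  by rewrite aff_scaleE aff_addE aff_scaleE mulr1.
have m_ge0 i x : 0 <= m i x :> R.
  rewrite mE mulr_ge0 ?invr_ge0 ?(ltW (BD i))//.
  by have := (hB i).2 x; rewrite ler_norml -[- _ <= _]subr_ge0 opprK => /andP[].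
have m_le i x : m i x <= D^-1 :> R.
  rewrite mE ler_pdivrMl// mulfK ?gt_eqF// mulr_natl mulr2n lerD2r.
  by have := (hB i).2 x; rewrite ler_norml => /andP[].
have summ x : \sum_i (m i x : R) <= 1.
  apply: (@le_trans _ _ (\sum_(i < d) D^-1)); first exact: ler_sum.
  by rewrite sumr_const card_ord -[_ *+ _]mulr_natl ler_pdivrMr// mul1r ler_nat.
have summ0 x : 0 <= \sum_i (m i x : R) by exact: sumr_ge0.
have D1 : D^-1 <= 1 by rewrite invf_le1// ler1n.
exists (option 'I_d), M; split.
  split; last first.
    by rewrite big_option [LHS]subrK.
  have one_x (x : K) : aff1 K x = 1 by [].
  case=> [i|]; split=> x.
  - exact: m_ge0.
  - by rewrite aff_subE one_x subr_ge0 (le_trans (m_le i x)).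
  - by rewrite aff_subE one_x aff_sumE subr_ge0.
  - by rewrite opprB addrC subrK aff_sumE.
move=> f.
have sumM : aff1 K = \sum_z M z by rewrite big_option [RHS]subrK.
have cM i : c i = (2 * B i * D) *: M (Some i) - B i *: \sum_z M z.
  by rewrite -sumM /= scalerA mulfV ?gt_eqF// scale1r addrK.
have span_c i : exists b : option 'I_d -> R, c i = \sum_z b z *: M z.
  exists (fun z => (z == Some i)%:R * (2 * B i * D) - B i).
  rewrite cM scaler_sumr.
  under [RHS]eq_bigr do rewrite scalerBl.
  rewrite sumrB; congr (_ - _).
  rewrite (bigD1 (Some i))//= eqxx mul1r big1 ?addr0// => z /negbTE ->.
  by rewrite mul0r scale0r.
have [b hb] := choice span_c.
exists (fun z => \sum_i (f (s i) : R) * b i z).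
rewrite {1}(cspan f).
under eq_bigr do rewrite {1}hb scaler_sumr.
rewrite exchange_big/=; apply: eq_bigr => z _.
by rewrite scaler_suml; apply: eq_bigr => i _; rewrite scalerA.
Qed.

End Frame.

(** * Nearest points and the bipolar theorem *)

Section Convex.
Context {R : realType}.

Lemma continuous_sum (T : topologicalType) (I : Type) (r : seq I)
    (F : I -> T -> R) :
  (forall i, continuous (F i)) -> continuous (fun x => \sum_(i <- r) F i x).
Proof.
move=> cF; elim: r => [|i r IH] x.
  by under eq_fun do rewrite big_nil; exact: cvg_cst.
under eq_fun do rewrite big_cons.
exact: (continuousD (cF i x) (IH x)).
Qed.

Lemma continuous_mul (T : topologicalType) (f g : T -> R) :
  continuous f -> continuous g -> continuous (fun x => f x * g x).
Proof. by move=> cf cg x; exact: (continuousM (cf x) (cg x)). Qed.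

Lemma linear_form_continuous n (a : 'I_n -> R) :
  continuous (fun r : 'rV[R]_n => \sum_i r 0 i * a i).
Proof.
apply: continuous_sum => i; apply: continuous_mul; last exact: cst_continuous.
exact: coord_continuous.
Qed.

Definition sqdist n (u v : 'rV[R]_n) : R := \sum_i (u 0 i - v 0 i) ^+ 2.

(** Only the part of C that is at most as far from v as a given point of C
matters, and it is compact. *)
Lemma nearest_point n (C : set 'rV[R]_n) (v : 'rV[R]_n) :
  closed C -> C !=set0 ->
  exists2 p, C p & forall q, C q -> sqdist v p <= sqdist v q.
Proof.
move=> clC [c0 Cc0].
pose D := [set q | C q /\ sqdist v q <= sqdist v c0].
have csq : continuous (sqdist v).
  apply: continuous_sum => i.
  have cd : continuous (fun u : 'rV[R]_n => v 0 i - u 0 i).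
    move=> x; have c1 : {for x, continuous (fun _ : 'rV[R]_n => v 0 i)}.
      exact: cst_continuous.
    have c2 : {for x, continuous (fun u : 'rV[R]_n => u 0 i)}.
      exact: coord_continuous.
    exact: (continuousB c1 c2).
  exact: (continuous_mul cd cd).
have clD : closed D.
  apply: closedI => //.
  exact: ((continuous_closedP _).1 csq _ (@closed_le R (sqdist v c0))).
have cD : compact D.
  pose A i : set R := [set` `[v 0 i - (sqdist v c0 + 1), v 0 i + (sqdist v c0 +
    1)]].
  have cA : compact [set q : 'rV[R]_n | forall i, A i (q 0 i)].
    by apply: rV_compact => i; exact: segment_compact.
  apply: (subclosed_compact clD cA) => q [_ Dq] i; rewrite /A /= in_itv /=.
  suff : `|v 0 i - q 0 i| <= sqdist v c0 + 1.
    by rewrite distrC ler_distl.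
  set t := `|_|.
  have : t ^+ 2 <= sqdist v c0.
    apply: le_trans Dq; rewrite /t real_normK ?num_real//.
    by rewrite /sqdist (bigD1 i)//= lerDl sumr_ge0// => j _; exact: sqr_ge0.
  have : 0 <= (t - 1) ^+ 2 by exact: sqr_ge0.
  have : 0 <= t by exact: normr_ge0.
  by nra.
have D0 : D !=set0 by exists c0; split.
have [p /set_mem[Cp pc] minp] := compact_EVT_min D0 cD (continuous_subspaceT csq).
exists p => // q Cq.
have [qc|/ltW qc] := leP (sqdist v q) (sqdist v c0).
  by apply: minp; apply/mem_set.
exact: le_trans qc.
Qed.

(** If p is the point of C nearest to w, then the scalar product with p - w is
nonnegative on C and vanishes at p: moving from p inside C cannot decrease the
distance to w. At w it equals minus the squared distance, so it separates w
from C unless w = p. *)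
Lemma cone_bipolar (W : vectType R) (C : properCone W) (w : W) :
  (forall h : dual W, dual_cone C h -> 0 <= h w :> R) -> pc_set C w.
Proof.
move=> hw.
pose e := vbasis {:W}.
have ef : basis_of {:W} e by exact: vbasisP.
pose CC := [set passmx.rVof e x | x in C].
have C0 : pc_set C 0.
  have [b [_ [Cb _ _]]] := pc_generating C 0.
  by rewrite -(scale0r b); apply: pc_scale.
have CC0 : CC !=set0 by exists (passmx.rVof e 0), 0.
have [_ [p Cp <-] minp] := nearest_point (passmx.rVof e w) (@pc_closed R W C) CC0.
pose u i : R := coord e i p - coord e i w.
pose ip (x : W) : R^o := \sum_i u i * coord e i x.
have ipl : linear ip.
  move=> a x y; rewrite /ip scaler_sumr -big_split/=; apply: eq_bigr => i _.
  by rewrite linearP /= mulrDr [in LHS]mulrCA.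
have ipD x y : ip (x + y) = ip x + ip y.
  by have := ipl 1 x y; rewrite !scale1r.
have ipZ a x : ip (a *: x) = a * ip x.
  by have := ipl a x 0; rewrite !addr0 => ->;
    rewrite (_ : ip 0 = 0) ?addr0// /ip big1// => i _; rewrite linear0 mulr0.
pose sq : R := \sum_i u i ^+ 2.
have sqE x : sqdist (passmx.rVof e w) (passmx.rVof e (p + x)) =
    sq + 2 * ip x + \sum_i coord e i x ^+ 2.
  rewrite /sqdist /sq /ip mulr_sumr -!big_split/=; apply: eq_bigr => i _.
  rewrite -!passmx.coord_rVof linearD /u /=; ring.
have key x : (exists2 t0 : R, 0 < t0 & forall t, 0 <= t <= t0 -> pc_set C (p +
  t *: x)) ->
    0 <= ip x.
  move=> [t0 t00 Ct]; rewrite leNgt; apply/negP => ipx.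
  pose N := \sum_i coord e i x ^+ 2.
  have N0 : 0 <= N by apply: sumr_ge0 => i _; exact: sqr_ge0.
  have step t : 0 <= t <= t0 -> 0 <= 2 * t * ip x + t ^+ 2 * N.
    move=> tt; have := minp _ (ex_intro2 _ _ _ (Ct t tt) erefl).
    rewrite -{1}[p]addr0 !sqE ipZ.
    rewrite (_ : ip 0 = 0) ?mulr0 ?addr0; last first.
      by rewrite /ip big1// => i _; rewrite linear0 mulr0.
    rewrite [X in sq + X <= _]big1 ?addr0; last first.
      by move=> i _; rewrite linear0 expr0n.
    rewrite -addrA lerDl; congr (0 <= _); congr (_ + _); first by rewrite mulrA.
    by rewrite /N mulr_sumr; apply: eq_bigr => i _; rewrite linearZ/= exprMn.
  (* A step so short that the quadratic term cannot make up for a descent. *)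
  pose t := Num.min t0 (- ip x / (N + 1)).
  have N1 : 0 < N + 1 by rewrite ltr_wpDl.
  have tp : 0 < t by rewrite lt_min t00 divr_gt0// oppr_gt0.
  have tt0 : t <= t0 by rewrite ge_min lexx.
  have t2 : t * (N + 1) <= - ip x by rewrite -ler_pdivlMr// ge_min lexx orbT.
  have := step t; rewrite ltW// tt0 => /(_ isT).
  rewrite (_ : _ + _ = t * (2 * ip x + t * N)); last by ring.
  rewrite pmulr_rge0// leNgt => /negP; apply.
  by nra.
have dC : dual_cone C (linfun ip).
  move=> x Cx; rewrite linfun_linearE//; apply: key; exists 1 => // t /andP[t0 _].
  by apply: pc_add => //; exact: pc_scale.
have ipp : ip p = 0.
  apply/eqP; rewrite eq_le; apply/andP; split.
    rewrite -oppr_ge0; have -> : - ip p = ip (- p) by rewrite -[- p]scaleN1r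
      ipZ mulN1r.
    apply: key; exists 1 => // t /andP[t0 t1].
    by rewrite scalerN -{1}[p]scale1r -scalerBl; apply: pc_scale => //;
      rewrite subr_ge0.
  apply: key; exists 1 => // t /andP[t0 t1].
  by apply: pc_add => //; exact: pc_scale.
have := hw _ dC; rewrite linfun_linearE//.
have ipw : ip w = - sq.
  have -> : ip w = ip p - sq.
    by rewrite /ip /sq -sumrB; apply: eq_bigr => i _; rewrite /u; ring.
  by rewrite ipp sub0r.
rewrite ipw oppr_ge0 => sq0.
have u0 i : u i = 0.
  apply/eqP; rewrite -sqrf_eq0 eq_le sqr_ge0 andbT (le_trans _ sq0)//.
  by rewrite /sq (bigD1 i)//= lerDl sumr_ge0// => j _; exact: sqr_ge0.
suff -> : w = p by [].
rewrite [LHS](coord_vbasis (memvf _)) [RHS](coord_vbasis (memvf _)).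
apply: eq_bigr => i _; congr (_ *: _).
by apply/esym/eqP; rewrite -subr_eq0; apply/eqP; exact: u0.
Qed.

End Convex.

(** * A martingale with one small increment *)

Lemma sum_tuple_rcons (T : nmodType) (Omega : finType) m (F : seq Omega -> T) :
  \sum_(z : m.+1.-tuple Omega) F z =
  \sum_(z : m.-tuple Omega) \sum_w F (rcons z w).
Proof.
rewrite pair_big /=.
pose h (p : m.-tuple Omega * Omega) : m.+1.-tuple Omega := [tuple of rcons p.1 p.2].
rewrite (reindex h) //=; apply: onW_bij; apply: inj_card_bij.
  move=> [z w] [z' w'] /(congr1 val)/= /rcons_inj[zz' ->].
  by congr pair; exact: val_inj.
by rewrite card_prod !card_tuple expnSr.
Qed.

Lemma sum_tuple0 (T : nmodType) (Omega : finType) (F : seq Omega -> T) :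
  \sum_(z : 0.-tuple Omega) F z = F [::].
Proof.
by rewrite (big_pred1 [tuple]) => // z; apply/esym/eqP; exact: tuple0.
Qed.

Section Martingale.
Context {R : realType} (Omega I : finType) (n : nat).
Variables (p : seq Omega -> R) (q : I -> seq Omega -> R).
Hypothesis n_gt0 : (0 < n)%N.
Hypothesis p_nil : p [::] = 1.
Hypothesis p_rcons : forall z, (size z < n)%N -> \sum_w p (rcons z w) = p z.
Hypothesis q_rcons :
  forall i z, (size z < n)%N -> \sum_w q i (rcons z w) = q i z.
Hypothesis q_ge0 : forall i z, 0 <= q i z.
Hypothesis q_le : forall i z, q i z <= p z.

Let a i z := q i z / p z.

Let p_ge0 (i0 : I) z : 0 <= p z.
Proof. exact: le_trans (q_ge0 i0 z) (q_le i0 z). Qed.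

Let qE i z : q i z = p z * a i z.
Proof.
have [p0|p0] := eqVneq (p z) 0; last by rewrite /a mulrCA mulfV// mulr1.
by rewrite p0 mul0r; apply/eqP; rewrite eq_le q_ge0 andbT -p0 q_le.
Qed.

Let a_le1 i z : 0 <= a i z <= 1.
Proof.
rewrite /a divr_ge0 ?(p_ge0 i)//=.
have [->|p0] := eqVneq (p z) 0; first by rewrite invr0 mulr0.
by rewrite ler_pdivrMr ?mul1r// lt_def p0 (p_ge0 i).
Qed.

Lemma sum_prob m : (m <= n)%N -> \sum_(z : m.-tuple Omega) p z = 1.
Proof.
elim: m => [|m IH] mn; first by rewrite sum_tuple0.
rewrite sum_tuple_rcons -[RHS](IH (ltnW mn)); apply: eq_bigr => z _.
by rewrite p_rcons// size_tuple.
Qed.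

Let energy m := \sum_(z : m.-tuple Omega) \sum_i p z * a i z ^+ 2.

Let jump m :=
  \sum_(z : m.-tuple Omega) \sum_w \sum_i
    p (rcons z w) * (a i (rcons z w) - a i z) ^+ 2.

Let jumpE m : (m < n)%N -> jump m = energy m.+1 - energy m.
Proof.
move=> mn.
rewrite /jump /energy.
rewrite (sum_tuple_rcons _ (fun z : seq Omega => \sum_i p z * a i z ^+ 2)).
rewrite -sumrB; apply: eq_bigr => z _.
rewrite exchange_big [in X in _ = X - _]exchange_big -sumrB.
apply: eq_bigr => i _.
have sz : (size z < n)%N by rewrite size_tuple.
(* By the martingale property, the mean of a(z w) over w is a(z). *)
have -> : p z * a i z ^+ 2 = \sum_w
    (2 * a i z * q i (rcons z w) - a i z ^+ 2 * p (rcons z w)).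
  rewrite sumrB -!mulr_sumr q_rcons// p_rcons// qE; ring.
rewrite -sumrB; apply: eq_bigr => w _; rewrite qE; ring.
Qed.

Let energy_le m : (m <= n)%N -> energy m <= #|I|%:R.
Proof.
move=> mn.
have -> : #|I|%:R = \sum_(z : m.-tuple Omega) #|I|%:R * p z.
  by rewrite -mulr_sumr sum_prob// mulr1.
apply: ler_sum => z _; rewrite mulr_natl -sumr_const.
apply: ler_sum => i _.
rewrite ler_piMr ?(p_ge0 i)//; have /andP[a0 a1] := a_le1 i z.
by rewrite expr_le1.
Qed.

Let small_jump : exists2 m, (m < n)%N & jump m <= #|I|%:R / n%:R.
Proof.
apply: contrapT => hn.
have big m : (m < n)%N -> #|I|%:R / n%:R < jump m.
  by move=> mn; rewrite ltNge; apply/negP => h; apply: hn; exists m.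
have : \sum_(m < n) #|I|%:R / n%:R < \sum_(m < n) jump m :> R.
  apply: ltr_sum => [|m _]; last exact: big.
  by rewrite has_predT /index_enum -enumT size_enum_ord.
rewrite sumr_const card_ord -[_ *+ _]mulr_natr divfK ?pnatr_eq0 -?lt0n//.
under eq_bigr do rewrite jumpE//.
rewrite -(big_mkord xpredT (fun m => energy m.+1 - energy m)) telescope_sumr//.
rewrite ltNge => /negP; apply; rewrite (le_trans _ (energy_le (leqnn n)))//.
rewrite gerDl oppr_le0 sumr_ge0// => z _; rewrite sumr_ge0// => i _.
by rewrite mulr_ge0 ?sqr_ge0 ?(p_ge0 i).
Qed.

(** With a = q / p, the vector of the a i is a martingale under the law p with
values between 0 and 1. Its energy, the expected sum of the squares, is at
most the cardinal of I and grows at each step by the expected square of the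
increment, so one of the n steps has an expected square of at most #|I| / n.
The bound on the mean absolute increment follows from |d| <= (1/s + s d^2) / 2
with s = sqrt n. *)
Lemma some_step_is_predictable :
  exists2 m, (m < n)%N & forall i,
    \sum_(z : m.-tuple Omega) \sum_w
      `|q i (rcons z w) - p (rcons z w) * (q i z / p z)|
    <= (1 + #|I|%:R) / 2 / Num.sqrt n%:R.
Proof.
have [m mn jm] := small_jump; exists m => // i.
set s := Num.sqrt _.
have s0 : 0 < s by rewrite sqrtr_gt0 ltr0n.
have s2 : s ^+ 2 = n%:R by rewrite sqr_sqrtr ?ler0n.
have term (z : seq Omega) w : `|q i (rcons z w) - p (rcons z w) * (q i z / p z)| <=
    (2 * s)^-1 * p (rcons z w) +
    s / 2 * (\sum_i p (rcons z w) * (a i (rcons z w) - a i z) ^+ 2).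
  rewrite -/(a i z) qE -mulrBr normrM (ger0_norm (p_ge0 i _)).
  set d := a i _ - a i z.
  apply: (@le_trans _ _ ((2 * s)^-1 * p (rcons z w) + s / 2 * (p (rcons z w) *
    d ^+ 2))).
    rewrite mulrC [X in _ <= X + _]mulrC -[X in _ + X]mulrC -mulrA [_ * (s /
      2)]mulrC.
    rewrite [leLHS]mulrC -mulrDr ler_wpM2l ?(p_ge0 i)//.
    have -> : (2 * s)^-1 + s / 2 * d ^+ 2 = (1 + (s * d) ^+ 2) / (2 * s).
      by field; rewrite gt_eqF.
    rewrite ler_pdivlMr ?mulr_gt0// -subr_ge0.
    have -> : (s * d) ^+ 2 = (s * `|d|) ^+ 2 by rewrite !exprMn real_normK
      ?num_real.
    have -> : 1 + (s * `|d|) ^+ 2 - `|d| * (2 * s) = (s * `|d| - 1) ^+ 2 by ring.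
    exact: sqr_ge0.
  rewrite lerD2l ler_wpM2l ?divr_ge0 ?(ltW s0)// (bigD1 i)//= lerDl.
  by rewrite sumr_ge0// => j _; rewrite mulr_ge0 ?sqr_ge0 ?(p_ge0 i).
apply: (@le_trans _ _ ((2 * s)^-1 + s / 2 * jump m)).
  have -> : (2 * s)^-1 = \sum_(z : m.-tuple Omega) \sum_w (2 * s)^-1 * p (rcons
    z w).
    under eq_bigr do rewrite -mulr_sumr.
    by rewrite -mulr_sumr -sum_tuple_rcons sum_prob ?mulr1.
  rewrite /jump mulr_sumr -big_split/=; apply: ler_sum => z _.
  rewrite mulr_sumr -big_split/=; apply: ler_sum => w _; exact: term.
apply: (@le_trans _ _ ((2 * s)^-1 + s / 2 * (#|I|%:R / n%:R))).
  by rewrite lerD2l ler_wpM2l// divr_ge0 ?(ltW s0).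
by rewrite -s2 le_eqVlt; apply/orP; left; apply/eqP; field; rewrite gt_eqF.
Qed.

End Martingale.

Section Measuring.
Context {R : realType} {VA VB : vectType R}.
Context (KA : stateSpace VA) (KB : stateSpace VB) (n : nat).
Implicit Types (y : mform KA KB n) (f : aff KA) (g : aff KB).

Lemma slots_linear y f (s t : seq (aff KB)) : multilinear y -> (size s < n)%N ->
  linear (fun g => y f (slots (s ++ g :: t))).
Proof.
move=> [_ ylin] sn.
have e g : slots (s ++ g :: t) =
    set_slot (slots (s ++ aff1 KB :: t)) (Ordinal sn) g.
  apply/funext => i; rewrite /slots /set_slot -val_eqE /=.
  rewrite !nth_cat; case: ltngtP => //= [|->]; last by rewrite subnn.
  by move=> si; rewrite -(prednK (n := i - size s)) ?subn_gt0.
by move=> a g h; rewrite (e (_ + _)) (e g) (e h); exact: ylin.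
Qed.

Lemma slots_rcons_one (s : seq (aff KB)) :
  slots (n := n) (rcons s (aff1 KB)) = slots s.
Proof.
apply/funext => i; rewrite /slots nth_rcons.
by case: ltngtP => // [/ltnW h|h]; rewrite nth_default// h.
Qed.

Lemma rcons_nseq (T : Type) k (x : T) : rcons (nseq k x) x = nseq k.+1 x.
Proof. by elim: k => //= k ->. Qed.

(** The identity behind moving the retained B-factor to the first slot, where
the constraints on B are read. *)
Lemma slots_swap (i0 im : 'I_n) (s : seq (aff KB)) g : val i0 = 0%N ->
    size s = im ->
  slots (rcons s g) \o tperm i0 im =
  (fun i => if val i == 0%N then g else (slots (rcons s (aff1 KB)) \o tperm i0
    im) i).
Proof.
move=> v0 sm; apply/funext => i /=; rewrite /slots.
case: (tpermP i0 im i) => [->|->|/eqP i0' /eqP im'].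
- by rewrite v0 eqxx nth_rcons sm ltnn eqxx.
- case: ifP => [/eqP im0|im0].
    by rewrite v0 nth_rcons sm im0 eqxx.
  by rewrite !nth_rcons v0 sm lt0n im0.
- rewrite -v0 val_eqE (negbTE i0') !nth_rcons sm.
  by rewrite val_eqE (negbTE im').
Qed.

Context (Omega : finType) (M : Omega -> aff KB).

Lemma slots_ge0 (z : seq Omega) : is_measurement M ->
  forall i, aff_ge0 KB (slots (n := n) (map M z) i).
Proof.
move=> [Meff _] i; rewrite /slots.
have [iz|iz] := ltnP i (size (map M z)); last by rewrite nth_default// => x;
  exact: ler01.
have /mapP[w _ ->] := mem_nth (aff1 KB) iz.
exact: (Meff w).1.
Qed.

(** The effects add up to 1, so forgetting the outcome of a slot discards the
factor. *)
Lemma sum_measured y f s t : multilinear y -> is_measurement M ->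
    (size s < n)%N ->
  \sum_w y f (slots (s ++ M w :: t)) = y f (slots (s ++ aff1 KB :: t)).
Proof.
move=> yl [_ M1] sn; have lin := slots_linear f t yl sn.
under eq_bigr do rewrite -(linfun_linearE lin).
by rewrite -linear_sum M1; exact: linfun_linearE.
Qed.

Lemma sum_measured_tuples y f m t : multilinear y -> is_measurement M ->
    (m + size t <= n)%N ->
  \sum_(z : m.-tuple Omega) y f (slots (map M z ++ t)) =
  y f (slots (nseq m (aff1 KB) ++ t)).
Proof.
move=> yl Mm; elim: m t => [|m IH] t mt.
  by rewrite (sum_tuple0 (fun z : seq Omega => y f (slots (map M z ++ t)))).
rewrite (sum_tuple_rcons _ (fun z : seq Omega => y f (slots (map M z ++ t)))).
under eq_bigr => z _.
  under eq_bigr do rewrite map_rcons cat_rcons.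
  rewrite sum_measured// ?size_map ?size_tuple;
    last by rewrite (leq_trans _ mt)// addSn ltnS leq_addr.
  over.
by rewrite IH /= ?addnS -?addSn// -cat_rcons rcons_nseq.
Qed.

End Measuring.

(** * The norms on A(K) and on its dual *)

Section Norms.
Context {R : realType} {VA VB : vectType R}.
Context (KA : stateSpace VA) (KB : stateSpace VB).
Implicit Types (phi : bitens KA KB).

Lemma ptensE (xA : dual (aff KA)) (xB : dual (aff KB)) f g :
  ptens xA xB f g = (xA f : R) * xB g :> R.
Proof.
rewrite /ptens linfun_linearE ?scale_lfunE//.
by move=> a u v; rewrite linearP scalerDl scalerA.
Qed.

Lemma ev_linear (V : vectType R) (K : stateSpace V) (x : K) :
  linear (fun f : aff K => f x).
Proof. by move=> a f g; rewrite aff_addE aff_scaleE. Qed.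

Definition ev (V : vectType R) (K : stateSpace V) (x : K) : dual (aff K) :=
  linfun (fun f : aff K => f x).

Lemma evE (V : vectType R) (K : stateSpace V) (x : K) f : ev x f = f x.
Proof. exact: (linfun_linearE (ev_linear x)). Qed.

Lemma ev_states (V : vectType R) (K : stateSpace V) (x : K) : states K (ev x).
Proof.
split; last by rewrite evE.
by move=> f f0; rewrite evE; exact: f0.
Qed.

Lemma ptens_max_states xA xB : states KA xA -> states KB xB ->
  max_states KA KB (ptens xA xB).
Proof.
move=> [xA0 xA1] [xB0 xB1]; split=> [f g f0 g0|];
  last by rewrite ptensE xA1 xB1 mulr1.
by rewrite ptensE mulr_ge0//; [exact: xA0|exact: xB0].
Qed.

Lemma bitens_sumE (I : Type) (r : seq I) (P : pred I) (F : I -> bitens KA KB) f g :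
  (\sum_(i <- r | P i) F i) f g = \sum_(i <- r | P i) F i f g :> R.
Proof. by rewrite !sum_lfunE. Qed.

Lemma bitens_scaleE (a : R) phi f g : (a *: phi) f g = a * phi f g :> R.
Proof. by rewrite !scale_lfunE. Qed.

Lemma bitens_linear_l phi g : linear (fun f => phi f g).
Proof.
move=> a u v; have -> : phi (a *: u + v) = a *: phi u + phi v by exact: linearP.
by rewrite add_lfunE scale_lfunE.
Qed.

Lemma bitens_comb (I J : Type) (r : seq I) (s : seq J) (a : I -> R) (b : J -> R)
    (F : I -> aff KA) (G : J -> aff KB) phi :
  phi (\sum_(i <- r) a i *: F i) (\sum_(j <- s) b j *: G j) =
  \sum_(i <- r) \sum_(j <- s) a i * (b j * phi (F i) (G j)) :> R.
Proof.
have := linfun_linearE (bitens_linear_l phi (\sum_(j <- s) b j *: G j)).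
move=> E; rewrite -E linear_sum; apply: eq_bigr => i _.
rewrite linearZ /= E linear_sum -mulr_sumr; congr (_ * _).
by apply: eq_bigr => j _; rewrite linearZ.
Qed.

(** Expand phi along the barycentric coordinates: its coefficients are
combinations of its values on products of effects, with weights independent of
phi, and the vectors of the expansion are products of points of the two state
spaces. *)
Lemma functional_bound (OA OB : finType) (MA : OA -> aff KA) (MB : OB -> aff KB) :
  spanning MA -> spanning MB ->
  exists (dA dB : nat) (s : 'I_dA -> KA) (t : 'I_dB -> KB),
  exists2 C : R, 0 <= C &
    forall phi (g : dual (bitens KA KB)) (delta L : R), 0 <= delta -> 0 <= L ->
      (forall i j, `|phi (MA i) (MB j) : R| <= delta) ->
      (forall i j, `|g (ptens (ev (s i)) (ev (t j))) : R| <= L) ->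
      `|g phi : R| <= C * delta * L.
Proof.
move=> spA spB.
have [dA [s [c [_ cE]]]] := aff_frame KA.
have [dB [t [e [_ eE]]]] := aff_frame KB.
have [bA hA] := choice (fun i => spA (c i)).
have [bB hB] := choice (fun i => spB (e i)).
exists dA, dB, s, t.
pose C i j := \sum_(a : OA) \sum_(b : OB) `|bA i a| * `|bB j b|.
have C0 i j : 0 <= C i j by do 2 (apply: sumr_ge0 => ? _); rewrite mulr_ge0.
exists (\sum_i \sum_j C i j); first by do 2 (apply: sumr_ge0 => ? _).
move=> phi g delta L delta0 L0 hphi hg.
have -> : phi = \sum_i \sum_j (phi (c i) (e j) : R) *: ptens (ev (s i)) (ev (t j)).
  apply/lfunP => f; apply/lfunP => h.
  rewrite {1}(cE f) {1}(eE h) bitens_comb bitens_sumE; apply: eq_bigr => i _.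
  rewrite bitens_sumE; apply: eq_bigr => j _.
  by rewrite bitens_scaleE ptensE !evE mulrA mulrC.
rewrite linear_sum (le_trans (ler_norm_sum _ _ _))// !mulr_suml.
apply: ler_sum => i _;
  rewrite linear_sum (le_trans (ler_norm_sum _ _ _))// !mulr_suml.
apply: ler_sum => j _; rewrite linearZ normrM ler_pM//; last exact: hg.
rewrite hA hB bitens_comb.
rewrite (le_trans (ler_norm_sum _ _ _))// !mulr_suml; apply: ler_sum => a _.
rewrite (le_trans (ler_norm_sum _ _ _))// !mulr_suml; apply: ler_sum => b _.
by rewrite mulrA !normrM ler_wpM2l ?mulr_ge0.
Qed.

Local Notation S := (max_states KA KB).

Lemma max_states_effect x f g : S x -> effects f -> effects g ->
  0 <= (x f g : R) <= 1.
Proof.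
move=> [x0 x1] [f0 f1] [g0 g1]; rewrite x0//=.
have h1 : (x f g : R) <= x f (aff1 KB).
  by have := x0 _ _ f0 g1; rewrite linearB/= subr_ge0.
have h2 : (x f (aff1 KB) : R) <= x (aff1 KA) (aff1 KB).
  have one0 : aff_ge0 KB (aff1 KB) by move=> ?; exact: ler01.
  by have := x0 _ _ f1 one0; rewrite linearB/= add_lfunE opp_lfunE subr_ge0.
by rewrite (le_trans h1)// (le_trans h2)// x1.
Qed.

Lemma unit_norm_ub (g : dual (bitens KA KB)) (t : R) : 0 <= t ->
  (forall x, S x -> `|g x : R| <= t) -> unit_norm S g <= t.
Proof.
move=> t0 ht; apply: ge_inf.
  by exists 0 => ? [].
by split=> // x Sx; rewrite -ler_norml; exact: ht.
Qed.

Lemma unit_norm_ge0 (g : dual (bitens KA KB)) : 0 <= unit_norm S g.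
Proof.
rewrite /unit_norm; set E := [set _ | _].
have [->|/set0P[t Et]] := eqVneq E set0; first by rewrite inf0.
by apply: lb_le_inf; [exists t|move=> ? []].
Qed.

Section Bounded.
Context (OA OB : finType) (MA : OA -> aff KA) (MB : OB -> aff KB).
Hypothesis (mA : is_measurement MA) (mB : is_measurement MB).
Hypothesis (spA : spanning MA) (spB : spanning MB).

(** Without this bound the infimum in [unit_norm] could be taken over the
empty set, and the norm would be 0 by convention. *)
Lemma max_states_bounded (g : dual (bitens KA KB)) :
  exists2 t : R, 0 <= t & forall x, S x -> `|g x : R| <= t.
Proof.
have [dA [dB [s [t [C C0 hC]]]]] := functional_bound spA spB.
pose L : R := \sum_i \sum_j `|g (ptens (ev (s i)) (ev (t j))) : R|.
have L0 : 0 <= L by do 2 (apply: sumr_ge0 => ? _).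
exists (C * 1 * L) => [|x Sx]; first by rewrite !mulr_ge0.
apply: hC => // [i j|i j].
  have /andP[x0 x1] := max_states_effect Sx (mA.1 i) (mB.1 j).
  by rewrite ger0_norm.
rewrite /L (bigD1 i)//= (bigD1 j)//= -addrA lerDl addr_ge0 ?sumr_ge0// => k _.
exact: sumr_ge0.
Qed.

Lemma unit_norm_le (g : dual (bitens KA KB)) x : S x ->
  `|g x : R| <= unit_norm S g.
Proof.
move=> Sx; have [t t0 ht] := max_states_bounded g.
apply: lb_le_inf.
  by exists t; split=> // z Sz; rewrite -ler_norml; exact: ht.
by move=> u [u0 hu]; rewrite ler_norml; exact: hu.
Qed.

(** Products of points are maximal states, so a functional of norm at most 1
is bounded by 1 on them. *)
Lemma dual_norm_bound : exists2 C : R, 0 <= C &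
  forall phi (delta : R), 0 <= delta ->
    (forall i j, `|phi (MA i) (MB j) : R| <= delta) ->
    forall g, unit_norm S g <= 1 -> `|g phi : R| <= C * delta.
Proof.
have [dA [dB [s [t [C C0 hC]]]]] := functional_bound spA spB.
exists C => // phi delta delta0 hphi g g1; rewrite -[leRHS]mulr1.
apply: hC => // i j; rewrite (le_trans _ g1)//; apply: unit_norm_le.
by apply: ptens_max_states; exact: ev_states.
Qed.

Lemma dual_unit_norm_le : exists2 C : R, 0 <= C &
  forall phi (delta : R), 0 <= delta ->
    (forall i j, `|phi (MA i) (MB j) : R| <= delta) ->
    dual_unit_norm S phi <= C * delta.
Proof.
have [C C0 hC] := dual_norm_bound; exists C => // phi delta delta0 hphi.
apply: ge_sup.
  exists `|(0 : dual (bitens KA KB)) phi : R|, 0 => //=.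
  by apply: unit_norm_ub => // x _; rewrite zero_lfunE normr0.
by move=> _ [g g1 <-]; exact: hC.
Qed.

(** When the norm of P vanishes, P cannot be normalized; but then P is 0 on
the products of points, which span. *)
Lemma dual_unit_norm_holder (P : dual (bitens KA KB)) phi :
  `|P phi : R| <= unit_norm S P * dual_unit_norm S phi.
Proof.
pose delta : R := \sum_i \sum_j `|phi (MA i) (MB j) : R|.
have delta0 : 0 <= delta by do 2 (apply: sumr_ge0 => ? _).
have hdelta i j : `|phi (MA i) (MB j) : R| <= delta.
  rewrite /delta (bigD1 i)//= (bigD1 j)//= -addrA lerDl addr_ge0 ?sumr_ge0// => k _.
  exact: sumr_ge0.
have [P0|P0] := eqVneq (unit_norm S P) 0.
  have [dA [dB [s [t [C C0 hC]]]]] := functional_bound spA spB.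
  have := hC phi P delta 0 delta0 (lexx _) hdelta; rewrite P0 mul0r mulr0; apply.
  move=> i j; rewrite -P0; apply: unit_norm_le.
  by apply: ptens_max_states; exact: ev_states.
have Pp : 0 < unit_norm S P by rewrite lt_def P0 unit_norm_ge0.
rewrite -ler_pdivrMl// -[_^-1]gtr0_norm ?invr_gt0// -normrM.
have [C C0 hC] := dual_norm_bound.
apply: ub_le_sup.
  by exists (C * delta) => _ [g g1 <-]; exact: hC.
exists ((unit_norm S P)^-1 *: P); last by rewrite scale_lfunE.
rewrite /=; apply: unit_norm_ub => // x Sx.
rewrite scale_lfunE normrM gtr0_norm ?invr_gt0// ler_pdivrMl// mulr1.
exact: unit_norm_le.
Qed.

End Bounded.
End Norms.

(** * Existence of the minimum over product states *)

Section Optimum.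
Context {R : realType}.

Lemma dual_sumE (W : vectType R) (I : Type) (r : seq I) (a : I -> R)
    (F : I -> dual W) f :
  (\sum_(i <- r) a i *: F i) f = \sum_(i <- r) a i * F i f :> R.
Proof.
rewrite sum_lfunE; apply: eq_bigr => i _; exact: scale_lfunE.
Qed.

Lemma closed_halfspace d (T : lmodType R) (l : T -> R) (e : 'I_d -> T) (a : R) :
  (forall (k : R) u v, l (k *: u + v) = k * l u + l v) ->
  closed [set r : 'rV[R]_d | a <= l (\sum_i r 0 i *: e i)].
Proof.
move=> lin.
have l0 : l 0 = 0.
  by have := lin 1 0 0; rewrite scaler0 addr0 mul1r => /eqP;
    rewrite -subr_eq0 opprD addrA subrr sub0r oppr_eq0 => /eqP.
have lE (r : 'rV[R]_d) : l (\sum_i r 0 i *: e i) = \sum_i r 0 i * l (e i).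
  by elim/big_rec2: _ => // i u v _ <-; rewrite lin.
rewrite (_ : [set r | _] =
    (fun r : 'rV[R]_d => \sum_i r 0 i * l (e i)) @^-1` [set x | a <= x]);
      last first.
  by apply/funext => r; rewrite /preimage /= lE.
have cl := (continuous_closedP _).1 (@linear_form_continuous R d (fun i => l (e
  i))).
by apply: cl; exact: closed_ge.
Qed.

Lemma functionals_separate (U : vectType R) (u : U) :
  (forall h : dual U, 0 <= h u :> R) -> u = 0.
Proof.
move=> hu; rewrite (coord_vbasis (memvf u)); apply: big1 => i _.
have lin : linear (coord (vbasis {:U}) i : U -> R^o) by move=> a x y;
  rewrite linearP.
suff -> : coord (vbasis {:U}) i u = 0 by rewrite scale0r.
apply/eqP; rewrite eq_le.
have := hu (linfun (coord (vbasis {:U}) i : U -> R^o)).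
have := hu (- linfun (coord (vbasis {:U}) i : U -> R^o)).
by rewrite opp_lfunE linfun_linearE// oppr_ge0 => -> ->.
Qed.

(** In the coordinates given by evaluation at an affine basis, the constrained
functionals are cut out of a box by closed half-spaces; this uses that
membership in a closed convex cone is a family of linear inequalities. *)
Lemma constrained_compact (V : vectType R) (K : stateSpace V) (c : constraints K) :
  exists (d : nat) (s : 'I_d -> K) (D : set 'rV[R]_d),
    [/\ compact D,
        forall r, D r -> constrained c (\sum_i r 0 i *: ev (s i)) &
        forall phi, constrained c phi ->
          exists2 r, D r & phi = \sum_i r 0 i *: ev (s i)].
Proof.
have [d [s [b [_ bE]]]] := aff_frame K.
have [B hB] := choice (fun i => let: ex_intro2 B B0 hB := aff_bounded (b i) in
  ex_intro (fun B : R => 0 < B /\ forall x, `|b i x : R| <= B) B (conj B0 hB)).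
pose phi_ (r : 'rV[R]_d) : dual (aff K) := \sum_i r 0 i *: ev (s i).
pose seg i : set R := [set` `[- B i, B i]].
pose box := [set r : 'rV[R]_d | forall i, seg i (r 0 i)].
pose E := [set r | constrained c (phi_ r)].
exists d, s, (box `&` E); split=> [|r []//|phi cphi].
- apply: compact_closedI; first by apply: (@rV_compact _ _ seg) => i;
    exact: segment_compact.
  have -> : E = [set r | forall f, aff_ge0 K f -> 0 <= phi_ r f :> R] `&`
      [set r | 1 <= phi_ r (aff1 K) :> R] `&`
      [set r | - 1 <= - phi_ r (aff1 K) :> R] `&`
      [set r | forall h : dual (cstr_U c), 0 <= h (cstr_F c (phi_ r)) :> R] `&`
      [set r | forall h : dual (cstr_W c), dual_cone (cstr_C c) h ->
                 0 <= h (cstr_G c (phi_ r)) :> R].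
    apply/seteqP; split=> r.
      move=> [[r0 r1] F0 GC]; split; first split; first split; first split => //.
      - by rewrite /= r1.
      - by rewrite /= r1.
      - by move=> h; rewrite F0 linear0.
      - by move=> h hC; exact: hC.
    move=> [[[[r0 r1] r2] F0] GC]; split; last exact: cone_bipolar.
      split=> //; apply/eqP; rewrite eq_le; apply/andP; split => //.
      by rewrite -lerN2.
    exact: functionals_separate.
  have hull (T : Type) (Q : set T) (X : T -> set 'rV[R]_d) :
      (forall t, Q t -> closed (X t)) ->
      closed [set r | forall t, Q t -> X t r].
    exact: closed_bigI.
  repeat apply: closedI.
  + apply: hull => f _; apply: (@closed_halfspace _ _ (fun phi : dual (aff K)
      => phi f)).
    by move=> k u v; rewrite add_lfunE scale_lfunE.
  + apply: (@closed_halfspace _ _ (fun phi : dual (aff K) => phi (aff1 K))).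
    by move=> k u v; rewrite add_lfunE scale_lfunE.
  + apply: (@closed_halfspace _ _ (fun phi : dual (aff K) => - phi (aff1 K))).
    by move=> k u v; rewrite add_lfunE scale_lfunE opprD mulrN.
  + have := hull _ setT (fun h : dual (cstr_U c) =>
      [set r | 0 <= h (cstr_F c (phi_ r)) :> R]).
    rewrite (_ : [set r | forall t, setT t -> _] =
        [set r | forall h : dual (cstr_U c), 0 <= h (cstr_F c (phi_ r)) :> R]);
          last first.
      by apply/seteqP; split=> r hr h; [exact: hr|move=> _; exact: hr].
    apply=> h _; apply: (@closed_halfspace _ _ (fun phi : dual (aff K) => h
      (cstr_F c phi))).
    by move=> k u v; rewrite !linearP.
  + apply: hull => h _.
    apply: (@closed_halfspace _ _ (fun phi : dual (aff K) => h (cstr_G c phi))).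
    by move=> k u v; rewrite !linearP.
- have phiE : phi = phi_ (\row_i phi (b i)).
    apply/lfunP => f; rewrite /phi_ dual_sumE {1}(bE f) linear_sum.
    by apply: eq_bigr => i _; rewrite linearZ mxE evE mulrC.
  exists (\row_i phi (b i)) => //; split; last by rewrite /E /= -phiE.
  move=> i; rewrite /seg /= in_itv /= mxE.
  have [[phi0 phi1] _ _] := cphi.
  have hb x : - B i <= (b i x : R) <= B i by rewrite -ler_norml; exact: (hB i).2.
  have phik k : phi (k *: aff1 K) = k :> R by rewrite linearZ -[RHS]mulr1 -phi1.
  apply/andP; split.
    have : 0 <= phi (b i + B i *: aff1 K) :> R.
      apply: phi0 => x; rewrite aff_addE aff_scaleE [aff1 K x]/= mulr1.
      by have /andP[h _] := hb x; rewrite -lerBlDr sub0r.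
    by rewrite linearD /= phik -lerBlDr sub0r.
  have : 0 <= phi (B i *: aff1 K - b i) :> R.
    apply: phi0 => x; rewrite aff_subE aff_scaleE [aff1 K x]/= mulr1 subr_ge0.
    by have /andP[] := hb x.
  by rewrite linearB /= phik subr_ge0.
Qed.

Context {VA VB : vectType R} (KA : stateSpace VA) (KB : stateSpace VB).

Lemma ptens_comb (I J : Type) (r : seq I) (s : seq J) (a : I -> R) (b : J -> R)
    (F : I -> dual (aff KA)) (G : J -> dual (aff KB)) :
  ptens (\sum_(i <- r) a i *: F i) (\sum_(j <- s) b j *: G j) =
  \sum_(i <- r) \sum_(j <- s) (a i * b j) *: ptens (F i) (G j).
Proof.
apply/lfunP => f; apply/lfunP => g.
rewrite ptensE !dual_sumE bitens_sumE mulr_suml; apply: eq_bigr => i _.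
rewrite bitens_sumE mulr_sumr; apply: eq_bigr => j _.
by rewrite bitens_scaleE ptensE mulrACA.
Qed.

Lemma product_minimum (P : dual (bitens KA KB)) (cA : constraints KA)
    (cB : constraints KB) :
  product_states (constrained cA) (constrained cB) !=set0 ->
  exists p, is_minimum
    [set (P x : R) | x in product_states (constrained cA) (constrained cB)] p.
Proof.
move=> [x0 [xA0 [xB0 [cA0 cB0 _]]]].
have [dA [s [DA [DAc DAs DAsurj]]]] := constrained_compact cA.
have [dB [t [DB [DBc DBs DBsurj]]]] := constrained_compact cB.
pose F (r : 'rV[R]_dA * 'rV[R]_dB) : R := \sum_i \sum_j
  r.1 0 i * r.2 0 j * P (ptens (ev (s i)) (ev (t j))).
have FE (r : 'rV[R]_dA) (q : 'rV[R]_dB) : P (ptens (\sum_i r 0 i *: ev (s i))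
  (\sum_i q 0 i *: ev (t i))) = F (r, q).
  rewrite ptens_comb linear_sum; apply: eq_bigr => i _.
  by rewrite linear_sum; apply: eq_bigr => j _; rewrite linearZ.
have Fc : continuous F.
  apply: continuous_sum => i; apply: continuous_sum => j.
  apply: continuous_mul; last exact: cst_continuous.
  apply: continuous_mul.
    move=> x; apply: (@continuous_comp _ _ _ fst (fun r : 'rV[R]_dA => r 0 i)).
      exact: cvg_fst.
    exact: coord_continuous.
  move=> x; apply: (@continuous_comp _ _ _ snd (fun r : 'rV[R]_dB => r 0 j)).
    exact: cvg_snd.
  exact: coord_continuous.
have [|r /set_mem[r1 r2] rmin] := compact_EVT_min _ (compact_setX DAc DBc)
  (continuous_subspaceT Fc).
  have [rA rAD _] := DAsurj _ cA0; have [rB rBD _] := DBsurj _ cB0.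
  by exists (rA, rB).
exists (F r); split.
  exists (ptens (\sum_i r.1 0 i *: ev (s i)) (\sum_i r.2 0 i *: ev (t i))).
    by exists (\sum_i r.1 0 i *: ev (s i)), (\sum_i r.2 0 i *: ev (t i));
      split; [exact: DAs|exact: DBs|].
  exact: (FE r.1 r.2).
move=> _ [_ [xA [xB [/DAsurj[rA rAD ->] /DBsurj[rB rBD ->] ->]]] <-].
by rewrite FE; apply: rmin; apply/mem_set.
Qed.

End Optimum.

(** * Conditional states of a measured extension *)

Section Mixture.
Context {R : realType} {VA VB : vectType R}.
Context (KA : stateSpace VA) (KB : stateSpace VB).

Lemma hom_scale0 (W U : vectType R) (L : 'Hom(W, U)) (a : R) u :
  L u = 0 -> L (a *: u) = 0.
Proof. by move=> Lu; rewrite linearZ /= Lu scaler0. Qed.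

Lemma hom_scale_ge0 (W U : vectType R) (L : 'Hom(W, U)) (h : dual U) (a : R) u :
  0 <= a -> 0 <= h (L u) :> R -> 0 <= h (L (a *: u)) :> R.
Proof. by move=> a0 hu; rewrite !linearZ mulr_ge0. Qed.

Lemma conv_hull_finType (T : vectType R) (S : set T) (I : finType) (Q : pred I)
    (p : I -> R) (a : I -> T) :
  (forall i, Q i -> 0 <= p i) -> \sum_(i | Q i) p i = 1 ->
  (forall i, Q i -> S (a i)) -> conv_hull S (\sum_(i | Q i) p i *: a i).
Proof.
move=> p0 p1 Sa.
have enumE (U : nmodType) (F : I -> U) :
    \sum_(i | Q i) F i = \sum_(k < #|Q|) F (enum_val k).
  by rewrite -(big_enum_val (A := Q) F).
exists #|Q|, (fun k => p (enum_val k)), (fun k => a (enum_val k)); split.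
- by move=> k; apply: p0; exact: enum_valP.
- by rewrite -p1 enumE.
- by move=> k; apply: Sa; exact: enum_valP.
- by rewrite enumE.
Qed.

Context (n : nat) (y : mform KA KB n).
Hypothesis (ymax : max_states_n y) (ysym : Defs.symmetric y).
Context (Omega : finType) (M : Omega -> aff KB).
Hypothesis Mm : is_measurement M.

Local Notation pr := (outcome_prob M y).

Let ylin : multilinear y. Proof. by case: ymax. Qed.

Lemma aff1_ge0 (V : vectType R) (K : stateSpace V) : aff_ge0 K (aff1 K).
Proof. by move=> x; exact: ler01. Qed.

Lemma slotA_linear gs : linear (fun f => y f gs).
Proof. exact: ylin.1. Qed.

Lemma measured_ge0 f (z : seq Omega) : aff_ge0 KA f ->
  0 <= y f (slots (map M z)) :> R.
Proof. by move=> f0; case: ymax => _ + _; apply => //; exact: slots_ge0. Qed.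

Definition measured_mixture m : bitens KA KB :=
  \sum_(z : m.-tuple Omega | pr z != 0)
    pr z *: ptens (cond_stateA M y z) (cond_stateB M y z).

Lemma cond_stateAE m (z : m.-tuple Omega) f :
  cond_stateA M y z f = y f (slots (map M z)) / pr z :> R.
Proof.
by rewrite /cond_stateA scale_lfunE linfun_linearE ?[_ *: _]mulrC//;
  exact: slotA_linear.
Qed.

Lemma slotB_linear m (z : m.-tuple Omega) f : (m < n)%N ->
  linear (fun g => y f (slots (rcons (map M z) g))).
Proof.
move=> mn a g h; rewrite -!cats1; apply: slots_linear => //.
by rewrite size_map size_tuple.
Qed.

Lemma cond_stateBE m (z : m.-tuple Omega) g : (m < n)%N ->
  cond_stateB M y z g = y (aff1 KA) (slots (rcons (map M z) g)) / pr z :> R.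
Proof.
move=> mn; rewrite /cond_stateB scale_lfunE linfun_linearE ?[_ *: _]mulrC//.
exact: slotB_linear.
Qed.

Lemma cond_stateA_states m (z : m.-tuple Omega) : pr z != 0 ->
  states KA (cond_stateA M y z).
Proof.
move=> p0; split=> [f f0|]; rewrite cond_stateAE ?divff//.
by rewrite divr_ge0 ?measured_ge0//; exact: aff1_ge0.
Qed.

Lemma slots_rcons_ge0 (z : seq Omega) g : aff_ge0 KB g ->
  forall i, aff_ge0 KB (slots (n := n) (rcons (map M z) g) i).
Proof.
move=> g0 i; rewrite /slots nth_rcons; case: ifP => _.
  exact: (slots_ge0 z Mm).
by case: ifP => _ //; exact: aff1_ge0.
Qed.

Lemma cond_stateB_states m (z : m.-tuple Omega) : (m < n)%N -> pr z != 0 ->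
  states KB (cond_stateB M y z).
Proof.
move=> mn p0; split=> [g g0|]; rewrite cond_stateBE//.
  apply: divr_ge0; last exact/measured_ge0/aff1_ge0.
  case: ymax => _ + _; apply; first exact: aff1_ge0.
  exact: slots_rcons_ge0.
by rewrite slots_rcons_one divff.
Qed.

(** The transposition of the slots 0 and m turns the retained B-factor into
the first one, and preserves y. *)
Lemma cond_stateB_first_slot m (z : m.-tuple Omega) : (m < n)%N ->
  exists2 gs : 'I_n -> aff KB, (forall i, aff_ge0 KB (gs i)) &
    forall f g, y f (slots (rcons (map M z) g)) =
      y f (fun i => if val i == 0%N then g else gs i).
Proof.
move=> mn; have n0 : (0 < n)%N by exact: leq_ltn_trans mn.
pose i0 := Ordinal n0; pose im := Ordinal mn.
exists (slots (rcons (map M z) (aff1 KB)) \o tperm i0 im) => [i|f g].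
  by apply: slots_rcons_ge0; exact: aff1_ge0.
by rewrite -slots_swap ?size_map ?size_tuple// ysym.
Qed.

Section Constrained.
Context (cA : constraints KA) (cB : constraints KB).
Hypothesis ysat : satisfies_constraints cA cB y.

Lemma cond_stateA_constrained m (z : m.-tuple Omega) : pr z != 0 ->
  constrained cA (cond_stateA M y z).
Proof.
move=> p0; have [FA _ GA _] := ysat; split; first exact: cond_stateA_states.
  exact: (hom_scale0 _ (FA (slots (map M z)))).
apply: cone_bipolar => h hC; apply: hom_scale_ge0.
  by rewrite invr_ge0; exact/measured_ge0/aff1_ge0.
by apply: GA => //; exact: slots_ge0.
Qed.

Lemma cond_stateB_constrained m (z : m.-tuple Omega) : (m < n)%N -> pr z != 0 ->
  constrained cB (cond_stateB M y z).
Proof.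
move=> mn p0; have [_ FB _ GB] := ysat.
have [gs gs0 gsE] := cond_stateB_first_slot z mn.
have LE : linfun (fun g => y (aff1 KA) (slots (rcons (map M z) g))) =
    linfun (fun g => y (aff1 KA) (fun i => if val i == 0%N then g else gs i)).
  by congr linfun; apply/funext => g; exact: gsE.
split; first exact: cond_stateB_states.
  by rewrite /cond_stateB LE; exact: (hom_scale0 _ (FB (aff1 KA) gs)).
apply: cone_bipolar => h hC; rewrite /cond_stateB LE; apply: hom_scale_ge0.
  by rewrite invr_ge0; exact/measured_ge0/aff1_ge0.
by apply: GB => //; exact: aff1_ge0.
Qed.

End Constrained.

Lemma prob_rcons f (z : seq Omega) : (size z < n)%N ->
  \sum_w y f (slots (map M (rcons z w))) = y f (slots (map M z)) :> R.
Proof.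
move=> zn; under eq_bigr do rewrite map_rcons -cats1.
by rewrite sum_measured ?size_map// cats1 slots_rcons_one.
Qed.

Lemma sum_outcome_prob m : (m <= n)%N ->
  \sum_(z : m.-tuple Omega | pr z != 0) pr z = 1.
Proof.
move=> mn; rewrite big_mkcond -[RHS](_ : y (aff1 KA) (slots [::]) = 1);
  last by case: ymax.
have -> : y (aff1 KA) (slots [::]) = y (aff1 KA) (slots (nseq m (aff1 KB) ++ [::])).
  congr (y _ _); elim: (m) => //= k IH.
  by rewrite cats0 -[_ :: _]/(nseq k.+1 _) -rcons_nseq slots_rcons_one -[nseq _
    _]cats0.
rewrite -(sum_measured_tuples (aff1 KA) (t := [::]) ylin Mm) ?addn0//.
apply: eq_bigr => z _; rewrite cats0 -/(outcome_prob M y z).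
by case: ifP => // /negbFE/eqP.
Qed.

Lemma measured_mixture_conv (SA : set (dual (aff KA))) (SB : set (dual (aff
  KB))) m :
  (m < n)%N ->
  (forall z : m.-tuple Omega, pr z != 0 ->
     SA (cond_stateA M y z) /\ SB (cond_stateB M y z)) ->
  conv_hull (product_states SA SB) (measured_mixture m).
Proof.
move=> mn hS; apply: conv_hull_finType.
- by move=> z _; exact/measured_ge0/aff1_ge0.
- exact/sum_outcome_prob/ltnW.
- by move=> z /hS[hA hB]; exists (cond_stateA M y z), (cond_stateB M y z).
Qed.

Context (x : bitens KA KB).
Hypothesis yx : forall f g, x f g = y f (slots [:: g]).
Context (OmegaA : finType) (MA : OmegaA -> aff KA).
Hypothesis MAm : is_measurement MA.
Hypothesis n_gt0 : (0 < n)%N.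

(** Evaluated on the effects MA i and M j, the mixture is the sum over z of
p(z j) a(z), and x is the sum over z of p(z j) a(z j): the difference is the
expected increment of the martingale on the event that the next outcome is j.
*)
Lemma measured_mixture_close : exists2 m, (m < n)%N &
  forall i j, `|(measured_mixture m - x) (MA i) (M j) : R| <=
    (1 + #|OmegaA|%:R) / 2 / Num.sqrt n%:R.
Proof.
pose p (z : seq Omega) : R := y (aff1 KA) (slots (map M z)).
pose q i (z : seq Omega) : R := y (MA i) (slots (map M z)).
have p_nil : p [::] = 1 by case: ymax.
have q_ge0 i z : 0 <= q i z by apply: measured_ge0; exact: (MAm.1 i).1.
have q_le i z : q i z <= p z.
  have yB : y (aff1 KA - MA i) (slots (map M z)) = p z - q i z :> R.
    have L := linfun_linearE (slotA_linear (slots (map M z))).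
    by rewrite -L linearB /= !L.
  by rewrite -subr_ge0 -yB; apply: measured_ge0; exact: (MAm.1 i).2.
have [m mn hm] := some_step_is_predictable n_gt0 p_nil
  (fun z => @prob_rcons (aff1 KA) z) (fun i z => @prob_rcons (MA i) z) q_ge0 q_le.
exists m => // i j; apply: le_trans (hm i).
have xE : x (MA i) (M j) = \sum_(z : m.-tuple Omega) q i (rcons z j) :> R.
  rewrite yx.
  have -> : y (MA i) (slots [:: M j]) =
      y (MA i) (slots (nseq m (aff1 KB) ++ [:: M j])).
    pose i0 := Ordinal n_gt0; pose im := Ordinal mn.
    rewrite -(ysym (tperm i0 im) _ (slots (nseq m _ ++ _))); congr (y _ _).
    have nth1 v : v != 0%N -> nth (aff1 KB) [:: M j] v = aff1 KB.
      by case: v => //= v _; rewrite nth_nil.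
    apply/funext => k; rewrite /= /slots cats1 nth_rcons nth_nseq size_nseq.
    case: (tpermP i0 im k) => [->|->|/eqP k0 /eqP km].
    + by rewrite /= ltnn eqxx.
    + by rewrite /i0 /im /=; case: (posnP m) => [->//|m0]; rewrite (nth1 m) -?lt0n.
    + rewrite nth1; last by rewrite -(val_eqE k i0) in k0.
      by rewrite -(val_eqE k im) /= in km; rewrite (negbTE km); rewrite !if_same.
  rewrite -(sum_measured_tuples (MA i) ylin Mm) ?addn1//.
  by apply: eq_bigr => z _; rewrite /q map_rcons cats1.
have wE : measured_mixture m (MA i) (M j) =
    \sum_(z : m.-tuple Omega) p (rcons z j) * (q i z / p z) :> R.
  rewrite bitens_sumE big_mkcond; apply: eq_bigr => z _;
    case: ifP => [p0|/negbFE/eqP p0].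
    rewrite bitens_scaleE ptensE cond_stateAE cond_stateBE// -map_rcons.
    rewrite -/(p _) -/(q _ _) mulrCA -[X in _ = _ * (_ / X)]/(pr z).
    by rewrite /q -!/(p _); field.
  by rewrite /p -/(pr z) p0 invr0 !mulr0.
rewrite add_lfunE opp_lfunE.
have -> : (measured_mixture m (MA i) + - x (MA i)) (M j) =
  measured_mixture m (MA i) (M j) - x (MA i) (M j) :> R by rewrite add_lfunE
    opp_lfunE.
rewrite wE xE -sumrB (le_trans (ler_norm_sum _ _ _))//; apply: ler_sum => z _.
rewrite (bigD1 j)//= distrC lerDl sumr_ge0// => w _.
Qed.

End Mixture.

Section Products.
Context {R : realType} {VA VB : vectType R}.
Context (KA : stateSpace VA) (KB : stateSpace VB) (n : nat).
Hypothesis n_gt0 : (0 < n)%N.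

Definition power_form (xA : dual (aff KA)) (xB : dual (aff KB)) : mform KA KB n :=
  fun f gs => (xA f : R) * \prod_i (xB (gs i) : R).

(** Extending a product by copies of xB makes every feasible product a point of
the relaxation, whose minimum is therefore at most the original one. *)
Lemma power_form_Sigma (cA : constraints KA) (cB : constraints KB) xA xB :
  constrained cA xA -> constrained cB xB -> Sigma n cA cB (ptens xA xB).
Proof.
move=> [[xA0 xA1] FA GA] [[xB0 xB1] FB GB].
pose i0 := Ordinal n_gt0.
have linA gs : linear (fun f => power_form xA xB f gs).
  by move=> a f g; rewrite /power_form linearP mulrDl /= -mulrA.
have prod_ge0 (P : pred 'I_n) gs : (forall i, aff_ge0 KB (gs i)) ->
    0 <= \prod_(i | P i) (xB (gs i) : R).
  by move=> gs0; apply: prodr_ge0 => i _; exact: xB0.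
have ext : is_extension (ptens xA xB) (power_form xA xB).
  split.
  - split.
    + split=> // f gs i a g h; rewrite /power_form.
      have E u : \prod_j (xB (set_slot gs i u j) : R) =
          (xB u : R) * \prod_(j | j != i) (xB (gs j) : R).
        rewrite (bigD1 i)//= /set_slot eqxx; congr (_ * _).
        by apply: eq_bigr => j /negbTE ->.
      rewrite !E linearP.
      have ring_id (k q u v r : R) :
        k * ((q * u + v) * r) = q * (k * (u * r)) + k * (v * r) by ring.
      exact: ring_id.
    + by move=> f gs f0 gs0; rewrite mulr_ge0//; [exact: xA0|exact: prod_ge0].
    + rewrite /power_form xA1 mul1r big1// => i _.
      by rewrite /slots nth_nil xB1.
  - move=> s f gs; rewrite /power_form; congr (_ * _).
    by rewrite [RHS](reindex_inj (@perm_inj _ s)).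
  - move=> f g; rewrite ptensE /power_form; congr (_ * _).
    rewrite (bigD1 i0)//= big1 ?mulr1// => i.
    by rewrite -val_eqE /slots /=; case: (val i) => //= k _; rewrite nth_nil xB1.
split.
  split; first by apply: ptens_max_states.
  by exists (power_form xA xB).
have EA gs : linfun (fun f => power_form xA xB f gs) = (\prod_i (xB (gs i) :
  R)) *: xA.
  by apply/lfunP => f; rewrite linfun_linearE// scale_lfunE [RHS]mulrC.
have EB f gs : linfun (fun g => power_form xA xB f (fun i => if val i == 0%N
  then g else gs i)) =
    ((xA f : R) * \prod_(i | i != i0) (xB (gs i) : R)) *: xB.
  have E g : power_form xA xB f (fun i => if val i == 0%N then g else gs i) =
      ((xA f : R) * \prod_(i | i != i0) (xB (gs i) : R)) * xB g.
    rewrite /power_form (bigD1 i0)//= [(xB g : R) * _]mulrC mulrA;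
      congr (_ * _ * _).
    by apply: eq_bigr => i; rewrite -val_eqE /= => /negbTE ->.
  apply/lfunP => g; rewrite linfun_linearE ?E ?scale_lfunE//.
  by move=> a u v; rewrite !E linearP mulrDr; congr (_ + _); exact: mulrCA.
exists (power_form xA xB); split=> //; split.
- by move=> gs; rewrite /tensA EA; exact: hom_scale0.
- by move=> f gs; rewrite /tensB EB; exact: hom_scale0.
- move=> h gs hC gs0; rewrite /tensA EA; apply: hom_scale_ge0;
    first exact: prod_ge0.
  exact: hC.
- move=> h f gs hC f0 gs0; rewrite /tensB EB; apply: hom_scale_ge0; last exact: hC.
  by rewrite mulr_ge0//; [exact: xA0|exact: prod_ge0].
Qed.

End Products.

(** * The rounding theorem *)

Lemma cvg_inv_sqrt (R : realType) :
  (Num.sqrt n%:R)^-1 @[n --> \oo] --> (0 : R).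
Proof.
have pos : \forall n \near \oo, 0 < Num.sqrt n%:R :> R.
  by near=> n; rewrite sqrtr_gt0 ltr0n; near: n; exact: nbhs_infty_gt.
apply/(gtr0_cvgV0 pos)/cvgryPge => A.
near=> n; apply: (le_trans (ler_norm A)).
rewrite -[`|A|]sqrtr_sqr ler_wsqrtr//.
by near: n; exact: nbhs_infty_ger.
Unshelve. all: by end_near. Qed.

Lemma conv_hull_ge (R : realType) (T : vectType R) (S : set T) (P : dual T) (b
  : R) x :
  (forall s, S s -> b <= P s :> R) -> conv_hull S x -> b <= P x :> R.
Proof.
move=> Pb [N [p [a [p0 p1 Sa ->]]]].
rewrite linear_sum -[b]mul1r -p1 mulr_suml; apply: ler_sum => i _.
by rewrite linearZ ler_wpM2l//; exact: Pb.
Qed.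

Theorem theorem4p2 (R : realType) (VA VB : vectType R)
    (KA : stateSpace VA) (KB : stateSpace VB) :
  exists (c : R) (Omega : finType) (M : Omega -> aff KB),
    [/\ is_measurement M,
        info_complete M,
        forall (n : nat) (x : bitens KA KB), (0 < n)%N -> Ext KA KB n x ->
          exists2 x' : bitens KA KB, sep_states KA KB x' &
            dual_unit_norm (max_states KA KB) (x' - x)
              <= 2 * c / Num.sqrt n%:R
      & forall (P : dual (bitens KA KB))
               (cA : constraints KA) (cB : constraints KB),
          product_states (constrained cA) (constrained cB) !=set0 ->
          exists pstar : R,
            is_minimum
              [set (P x : R) |
                 x in product_states (constrained cA) (constrained cB)] pstar
            /\
            forall (x : nat -> bitens KA KB) (y : forall n, mform KA KB n),
              (forall n, (0 < n)%N ->
                 is_minimizer P (Sigma n cA cB) (x n) /\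
                 is_Sigma_extension cA cB (x n) (y n)) ->
              exists w : nat -> bitens KA KB,
                (forall n, (0 < n)%N ->
                   [/\ explicitly_constructible M (y n) (w n),
                       conv_hull
                         (product_states (constrained cA) (constrained cB))
                         (w n),
                       dual_unit_norm (max_states KA KB) (w n - x n)
                         <= 2 * c / Num.sqrt n%:R,
                       0 <= (P (w n) : R) - pstar
                     & (P (w n) : R) - pstar
                         <= unit_norm (max_states KA KB) P
                              * (2 * c / Num.sqrt n%:R)]) /\
                ((P (w n) : R) @[n --> \oo] --> pstar) ].
Proof.
have [OA [MA [MAm spA]]] := exists_spanning_measurement KA.
have [OB [M [Mm spB]]] := exists_spanning_measurement KB.
have [C C0 hC] := dual_unit_norm_le MAm Mm spA spB.
(* Chosen so that 2 * c is C times the constant of the martingale bound. *)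
pose c := C * (1 + #|OA|%:R) / 4.
have cE n : 2 * c / Num.sqrt n%:R = C * ((1 + #|OA|%:R) / 2 / Num.sqrt n%:R).
  by rewrite /c [RHS]mulrA; congr (_ / _); field; done.
have delta0 n : 0 <= (1 + #|OA|%:R) / 2 / Num.sqrt n%:R :> R.
  by rewrite !divr_ge0 ?sqrtr_ge0// addr_ge0.
have close n (x : bitens KA KB) (y : mform KA KB n) : (0 < n)%N -> is_extension
  x y ->
    exists2 m, (m < n)%N &
      dual_unit_norm (max_states KA KB) (measured_mixture y M m - x) <= 2 * c /
        Num.sqrt n%:R.
  move=> n0 [ymax ysym yx].
  have [m mn hm] := measured_mixture_close ymax ysym Mm yx MAm n0.
  by exists m => //; rewrite cE; exact: hC.
exists c, OB, M; split=> //; first exact: spanning_info_complete.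
  move=> n x n0 [_ [y yx]]; have [m mn hm] := close n x y n0 yx.
  exists (measured_mixture y M m) => //; case: yx => ymax ysym _.
  apply: measured_mixture_conv => // z p0.
  by split; [exact: cond_stateA_states|exact: cond_stateB_states].
move=> P cA cB feas; have [pstar minp] := product_minimum P feas.
exists pstar; split=> // x y hxy.
pose good n (w : bitens KA KB) :=
  [/\ explicitly_constructible M (y n) w,
      conv_hull (product_states (constrained cA) (constrained cB)) w,
      dual_unit_norm (max_states KA KB) (w - x n) <= 2 * c / Num.sqrt n%:R,
      0 <= (P w : R) - pstar &
      (P w : R) - pstar <=
        unit_norm (max_states KA KB) P * (2 * c / Num.sqrt n%:R)].
have exw n : exists w, (0 < n)%N -> good n w.
  have [->|n0] := posnP n; first by exists 0.
  have [[xS xmin] [yx ysat]] := hxy n n0.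
  have [m mn hm] := close n (x n) (y n) n0 yx.
  have [ymax ysym _] := yx.
  have wfeas : conv_hull (product_states (constrained cA) (constrained cB))
      (measured_mixture (y n) M m).
    apply: measured_mixture_conv => // z p0; split.
      exact: (cond_stateA_constrained ymax Mm ysat).
    exact: (cond_stateB_constrained ymax ysym Mm ysat).
  exists (measured_mixture (y n) M m) => _; split=> //.
  - by exists m.
  - by rewrite subr_ge0; apply: (conv_hull_ge _ wfeas) => s Ss; apply: minp.2;
      exists s.
  have [[_ [xA [xB [hA hB ->]]] pE] _] := minp.
  have xp : (P (x n) : R) <= pstar by rewrite -pE; apply: xmin;
    exact: power_form_Sigma.
  apply: (@le_trans _ _ (P (measured_mixture (y n) M m - x n))).
    by rewrite linearB /= lerB.
  apply: (le_trans (ler_norm _)).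
  apply: (le_trans (dual_unit_norm_holder MAm Mm spA spB P _)).
  by rewrite ler_wpM2l// unit_norm_ge0.
have [w hw] := choice exw.
exists w; split; first exact: hw.
pose K := unit_norm (max_states KA KB) P * (2 * c).
have ub : pstar + K * (Num.sqrt n%:R)^-1 @[n --> \oo] --> pstar.
  rewrite -[X in _ --> X]addr0 -[X in _ + X](mulr0 K).
  apply: cvgD; first exact: cvg_cst.
  by apply: cvgM; [exact: cvg_cst|exact: cvg_inv_sqrt].
apply: (squeeze_cvgr _ (cvg_cst pstar) ub).
near=> n; have n0 : (0 < n)%N by near: n; exact: nbhs_infty_gt.
have [_ _ _ h1 h2] := hw n n0.
by rewrite -subr_ge0 h1/= -lerBlDl /K -mulrA.
Unshelve. all: by end_near. Qed.
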